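(* Let $r>0$, let $f:[0,\infty)\to(0,\infty)$ be a $C^1$ non-increasing function, and let $w:(0,\infty)\to[0,\infty)$ be defined by $w(t)=-\frac{f'(t)}{t}$. For any convex set $E\subset\mathbb{R}^2$ of class $C^{1,1}$ containing the origin with $|E|_w=|B_r|_w$ it holds $$\int_{\partial E}H_{\partial E}\,f(|x|)\,d\mathcal{H}^1\le\int_{\partial B_r}H_{\partial B_r}\,f(|x|)\,d\mathcal{H}^1 .\qquad( * )$$ If moreover $w$ is non-increasing, then $( * )$ holds for any convex set $E\subset\mathbb{R}^2$ of class $C^{1,1}$ with $|E|_w=|B_r|_w$ (not necessarily containing the origin).
   Context: $B_r\subset\mathbb{R}^2$ is the ball of radius $r$ centered at the origin. For measurable $E\subset\mathbb{R}^2$ the weighted area is $|E|_w=\int_E w(|x|)\,dx$. $\mathcal{H}^1$ is the one-dimensional Hausdorff measure. A set of class $C^{1,1}$ is an open set which near each boundary point is, in suitable Cartesian coordinates, the subgraph of a $C^{1,1}$ function $u$; $H_{\partial E}$ is the curvature of $\partial E$ with respect to the exterior normal, defined $\mathcal{H}^1$-a.e. on $\partial E$ by $H_{\partial E}=-\operatorname{div}\big(Du/\sqrt{1+|Du|^2}\big)$ in such a representation (so it is nonnegative for convex sets and $H_{\partial B_r}=1/r$). *)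

(* Defs.v *)
From HB Require Import structures.
From mathcomp Require Import all_boot all_order all_algebra.
From mathcomp Require Import all_classical all_reals all_analysis.

Set Implicit Arguments.
Unset Strict Implicit.
Unset Printing Implicit Defensive.

Import Order.TTheory GRing.Theory Num.Theory.
Import numFieldNormedType.Exports.

Local Open Scope classical_set_scope.
Local Open Scope ring_scope.

Section plane.
Context {R : realType}.
Implicit Types (E A : set (R * R)) (x y tau nu : R * R) (f u w : R -> R).

(* The library norm on R * R is the sup norm, hence the Euclidean one here;
   the topology and the Borel sets of R * R are the same for both. *)
Definition dotp x y : R := x.1 * y.1 + x.2 * y.2.

Definition enorm x : R := Num.sqrt (dotp x x).

Definition eball (r : R) : set (R * R) := [set x | enorm x < r].

Definition boundary E : set (R * R) := closure E `\` E°.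

Definition weighted_area w E : \bar R :=
  \int[(lebesgue_measure \x lebesgue_measure)%E]_(x in E) (w (enorm x))%:E.

(* 0 is adjoined so that the empty set has diameter 0 rather than -oo. *)
Definition ediam A : \bar R :=
  ereal_sup (0%E |` [set (enorm (p.1 - p.2))%:E | p in A `*` A]).

Definition hausdorff1_pre (delta : R) A : \bar R :=
  ereal_inf [set (\sum_(0 <= k <oo) ediam (F k))%E |
    F in [set F : (set (R * R))^nat |
      (forall k, (ediam (F k) <= delta%:E)%E) /\ A `<=` \bigcup_k F k]].

Definition hausdorff1 A : \bar R :=
  ereal_sup [set hausdorff1_pre delta A | delta in [set d : R | 0 < d]].

Definition C11_near0 u : Prop :=
  exists2 d : R, 0 < d &
    {in `]- d, d[, forall s, derivable u s 1} /\
    [lipschitz derive1 u s | s in [set` `]- d, d[]].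

(* Near x, E is the subgraph of u in the Cartesian coordinates with origin x
   and orthonormal axes tau (abscissa) and nu (ordinate). *)
Definition C11_subgraph_at E x tau nu u : Prop :=
  [/\ dotp tau tau = 1, dotp nu nu = 1, dotp tau nu = 0, C11_near0 u &
      \forall y \near x, E y <-> dotp (y - x) nu < u (dotp (y - x) tau)].

Definition C11_set E : Prop :=
  open E /\
  forall x, boundary E x -> exists tau nu u, C11_subgraph_at E x tau nu u.

(* As u depends on one variable, div (Du / sqrt (1 + |Du|^2)) is the derivative
   of u' / sqrt (1 + u'^2); it is taken at the abscissa 0 of x. *)
Definition is_curvature E x (h : R) : Prop :=
  exists tau nu u, C11_subgraph_at E x tau nu u /\
    is_derive (0 : R) (1 : R)
      (fun s => derive1 u s / Num.sqrt (1 + derive1 u s ^+ 2)) (- h).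

(* The value does not depend on the subgraph representation; it is 0 on the
   H^1-null set of boundary points where the above derivative does not exist. *)
Definition curvature E x : R := xget 0 [set h | is_curvature E x h].

Definition weighted_curvature f E : \bar R :=
  \int[hausdorff1]_(x in boundary E) (curvature E x * f (enorm x))%:E.

(* C^1 on [0, +oo[, with the one-sided derivative at 0. *)
Definition C1_halfline f : Prop :=
  exists f' : R -> R,
    [/\ {within `[0, +oo[, continuous f'},
        forall t : R, 0 < t -> is_derive t 1 f (f' t) &
        (f h - f 0) / h @[h --> 0^'+] --> f' 0].

End plane.

(* Main.v *)
(** In polar coordinates around the origin, E convex and w >= 0 give, for every
    direction e and every boundary point x with outer normal e,
      \int_{t > 0, t e in E} w(t) t dt <= f(0) - f(|x|),
    because <y, e> <= <x, e> <= |x| for all y in E. The Gauss map sends H dH^1 to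
    the angular measure, so integrating over e bounds the left-hand side of the
    claim by 2 pi f(0) - |E|_w = 2 pi f(0) - |B_r|_w = 2 pi f(r), which is the
    value of the right-hand side.

    Directions are parametrised by their slope, e = +-(1, m) / sqrt (1 + m^2), with
    angular measure dm / (1 + m^2). Only one inequality of the area formula for the
    Gauss map is needed, and it is local: where the curvature is positive, the
    boundary point is locally a Lipschitz function of m, so the Hausdorff measure
    of a piece of boundary is controlled by the Lebesgue measure of its slopes. *)
Require Import Defs.
From mathcomp Require Import all_boot all_order all_algebra.
From mathcomp Require Import all_classical all_reals all_analysis.
From mathcomp Require Import measurable_realfun.
From mathcomp Require Import ring lra.

Import Order.TTheory GRing.Theory Num.Theory.
Import numFieldNormedType.Exports.
Import HBNNSimple.

Set Implicit Arguments.
Unset Strict Implicit.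
Unset Printing Implicit Defensive.

Local Open Scope classical_set_scope.
Local Open Scope ring_scope.

(** * Euclidean geometry of the plane *)

(** The proof uses neither measurability of [curvature] nor additivity of [hausdorff1]. The integral
    over the boundary of [E] is bounded one simple function at a time: on a level set of value c
    only the inequality c <= H f(|x|) is used, and additivity over the levels is transferred to the
    slopes, where Lebesgue measure is at hand. This works because a supporting line has a single
    contact point as soon as the curvature is nonzero at one of them, so that different levels have
    disjoint sets of slopes. The weight f(|x|) is replaced from the start by a function of the slope
    alone, f(0) / (1 + m^2) minus the weighted area of [E] per unit slope along the ray. The two
    vertical normals, which have no slope, belong to at most one curved point each. On the disc the
    opposite inequality is needed; there the integrand is a positive constant, and a lower bound for
    the length of the circle is enough. *)

Section plane_geometry.
Context {R : realType}.
Implicit Types (x y z n tau nu : R * R) (E A : set (R * R)).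

Lemma dotpC x y : dotp x y = dotp y x.
Proof. by rewrite /dotp mulrC [x.2 * _]mulrC. Qed.

Lemma dotpDl x y z : dotp (x + y) z = dotp x z + dotp y z.
Proof. by rewrite /dotp /=; ring. Qed.

Lemma dotpBl x y z : dotp (x - y) z = dotp x z - dotp y z.
Proof. by rewrite /dotp /=; ring. Qed.

Lemma dotpZl (c : R) x z : dotp (c *: x) z = c * dotp x z.
Proof. by rewrite /dotp /= /GRing.scale /=; ring. Qed.

Lemma dotpxx_ge0 x : 0 <= dotp x x.
Proof. by rewrite /dotp -!expr2 addr_ge0 ?sqr_ge0. Qed.

Lemma enorm_ge0 x : 0 <= enorm x.
Proof. exact: sqrtr_ge0. Qed.

Lemma sqr_enorm x : enorm x ^+ 2 = dotp x x.
Proof. by rewrite /enorm sqr_sqrtr ?dotpxx_ge0. Qed.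

Lemma dotp_sqr_le x y : dotp x y ^+ 2 <= dotp x x * dotp y y.
Proof.
rewrite -subr_ge0.
have -> : dotp x x * dotp y y - dotp x y ^+ 2 = (x.1 * y.2 - x.2 * y.1) ^+ 2.
  by rewrite /dotp; ring.
exact: sqr_ge0.
Qed.

Lemma dotp_le x y : dotp x y <= enorm x * enorm y.
Proof.
rewrite (le_trans (ler_norm _))// -(ler_pXn2r (ltn0Sn 1)) ?nnegrE//.
  by rewrite exprMn !sqr_enorm real_normK ?num_real// dotp_sqr_le.
by rewrite mulr_ge0// enorm_ge0.
Qed.

Lemma normr_dotp_le x n : enorm n = 1 -> `|dotp x n| <= enorm x.
Proof.
move=> n1; have := dotp_sqr_le x n.
rewrite -!sqr_enorm n1 expr1n mulr1 -real_normK ?num_real//.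
by rewrite ler_pXn2r// nnegrE// enorm_ge0.
Qed.

Lemma enormD x y : enorm (x + y) <= enorm x + enorm y.
Proof.
rewrite -(ler_pXn2r (ltn0Sn 1)) ?nnegrE ?addr_ge0 ?enorm_ge0//.
rewrite sqrrD !sqr_enorm.
have -> : dotp (x + y) (x + y) = dotp x x + dotp x y *+ 2 + dotp y y.
  by rewrite /dotp /=; ring.
by rewrite lerD2r lerD2l lerMn2r dotp_le.
Qed.

Lemma enormZ (c : R) x : enorm (c *: x) = `|c| * enorm x.
Proof.
rewrite /enorm -sqrtr_sqr -sqrtrM ?sqr_ge0//; congr Num.sqrt.
by rewrite /dotp /= /GRing.scale /=; ring.
Qed.

Lemma enormN x : enorm (- x) = enorm x.
Proof. by rewrite /enorm; congr Num.sqrt; rewrite /dotp /=; ring. Qed.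

Lemma enormB x y : enorm (x - y) = enorm (y - x).
Proof. by rewrite -enormN opprB. Qed.

Lemma enorm_dist x y z : enorm (x - z) <= enorm (x - y) + enorm (y - z).
Proof. by have := enormD (x - y) (y - z); rewrite addrA subrK. Qed.

Lemma enorm0 : enorm (0 : R * R) = 0.
Proof. by rewrite /enorm /dotp /= !mul0r addr0 sqrtr0. Qed.

Lemma enorm0_eq0 x : enorm x = 0 -> x = 0.
Proof.
move=> /(congr1 (fun t => t ^+ 2)); rewrite sqr_enorm expr0n /= /dotp -!expr2.
move/eqP; rewrite paddr_eq0 ?sqr_ge0// !sqrf_eq0 => /andP[/eqP x1 /eqP x2].
by case: x x1 x2 => a b /= -> ->.
Qed.

Lemma enorm_gt0 x : x != 0 -> 0 < enorm x.
Proof.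
move=> x0; rewrite lt_neqAle enorm_ge0 andbT eq_sym.
by apply: contra x0 => /eqP/enorm0_eq0 ->.
Qed.

Lemma fst_le_enorm x : `|x.1| <= enorm x.
Proof.
by rewrite -sqrtr_sqr /enorm ler_wsqrtr// /dotp -!expr2 lerDl sqr_ge0.
Qed.

Lemma snd_le_enorm x : `|x.2| <= enorm x.
Proof.
by rewrite -sqrtr_sqr /enorm ler_wsqrtr// /dotp -!expr2 lerDr sqr_ge0.
Qed.

Lemma enorm_le_add x : enorm x <= `|x.1| + `|x.2|.
Proof.
rewrite -(ler_pXn2r (ltn0Sn 1)) ?nnegrE ?addr_ge0 ?enorm_ge0//.
rewrite sqr_enorm sqrrD !real_normK ?num_real// /dotp -!expr2 addrAC lerDl.
by rewrite mulrn_wge0 ?mulr_ge0.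
Qed.

(** By Lagrange's identity the determinant of [tau] and [nu] is 1 or -1, so [nu] is [tau] turned by
    a right angle one way or the other. Hence the matrix of the frame also has orthonormal columns,
    which is what the expansion needs. *)
Lemma orthonormal_expand tau nu x : dotp tau tau = 1 -> dotp nu nu = 1 ->
  dotp tau nu = 0 -> x = dotp x tau *: tau + dotp x nu *: nu.
Proof.
case: tau nu x => [t1 t2] [n1 n2] [x1 x2]; rewrite /dotp /= => tt nn tn.
have d2 : (t1 * n2 - t2 * n1) ^+ 2 = 1.
  have -> : (t1 * n2 - t2 * n1) ^+ 2 = (t1 * t1 + t2 * t2) * (n1 * n1 + n2 * n2)
     - (t1 * n1 + t2 * n2) ^+ 2 by ring.
  by rewrite tt nn tn; ring.
have n1E : n1 = - t2 * (t1 * n2 - t2 * n1).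
  rewrite -[LHS]mulr1 -tt.
  transitivity (t1 * (t1 * n1 + t2 * n2) - t2 * (t1 * n2 - t2 * n1)); first ring.
  by rewrite tn; ring.
have n2E : n2 = t1 * (t1 * n2 - t2 * n1).
  rewrite -[LHS]mulr1 -tt.
  transitivity (t2 * (t1 * n1 + t2 * n2) + t1 * (t1 * n2 - t2 * n1)); first ring.
  by rewrite tn; ring.
have tr : t1 * t1 + n1 * n1 = 1 /\ t2 * t2 + n2 * n2 = 1
    /\ t1 * t2 + n1 * n2 = 0.
  move/eqP: d2; rewrite -subr_eq0 subr_sqr_1 mulf_eq0 subr_eq0 addr_eq0.
  case/orP => /eqP d; (have : n1 = - t2 /\ n2 = t1 \/ n1 = t2 /\ n2 = - t1;
    last by case=> [] [-> ->]; rewrite -tt; repeat split; ring).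
    by left; rewrite d in n1E n2E; rewrite {1}n1E {1}n2E; split; ring.
  by right; rewrite d in n1E n2E; rewrite {1}n1E {1}n2E; split; ring.
have [a [b c]] := tr.
congr pair; rewrite /= /GRing.scale /=.
  transitivity (x1 * (t1 * t1 + n1 * n1) + x2 * (t1 * t2 + n1 * n2)); last ring.
  by rewrite a c; ring.
transitivity (x1 * (t1 * t2 + n1 * n2) + x2 * (t2 * t2 + n2 * n2)); last ring.
by rewrite b c; ring.
Qed.

Lemma nbhs_enormP x (P : set (R * R)) :
  nbhs x P <-> exists2 d : R, 0 < d & forall y, enorm (y - x) < d -> P y.
Proof.
split=> [/nbhs_ballP[d /= d0 dP]|[d d0 dP]].
  exists d => // y yx; apply: dP; rewrite /ball /= /prod_ball /ball /=.
  split; rewrite distrC; apply: le_lt_trans yx.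
    exact: (fst_le_enorm (y - x)).
  exact: (snd_le_enorm (y - x)).
apply/nbhs_ballP; exists (d / 2); first by rewrite /= divr_gt0.
move=> y [/=]; rewrite /ball /= => y1 y2; apply: dP.
rewrite (le_lt_trans (enorm_le_add _))//= (splitr d) distrC [`|y.2 - _|]distrC.
exact: ltrD.
Qed.

Lemma closure_enormP E x :
  closure E x <-> forall d : R, 0 < d -> exists2 y, E y & enorm (y - x) < d.
Proof.
split=> [cEx d d0|H B /nbhs_enormP[d d0 dB]].
  have /cEx[y [Ey yd]] : nbhs x [set y | enorm (y - x) < d].
    by apply/nbhs_enormP; exists d.
  by exists y.
by have [y Ey yd] := H d d0; exists y; split => //; exact: dB.
Qed.

Lemma open_enormP E : open E ->
  forall x, E x -> exists2 d : R, 0 < d & forall y, enorm (y - x) < d -> E y.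
Proof. by rewrite openE => oE x /oE/nbhs_enormP. Qed.

Lemma boundary_openE E : open E -> boundary E = closure E `\` E.
Proof. by move=> /interior_id; rewrite /boundary => ->. Qed.

Lemma convex_setP E : convex_set E -> forall x y (t : R), 0 <= t -> t <= 1 ->
  E x -> E y -> E (x + t *: (y - x)).
Proof.
move=> cE x y t t0 t1 Ex Ey.
have tI : Itv.spec (@Itv.num_sem R) (Itv.Real `[0%Z, 1%Z]%R) t.
  by rewrite /= /Itv.num_sem /= num_real /= in_itv /= t0 t1.
have := cE y x (Itv.mk tI); rewrite !inE => /(_ Ey Ex).
congr (E _); rewrite /conv /=.
by rewrite scalerBr scalerBl scale1r addrC -addrA [- _ + _]addrC.
Qed.

Lemma continuous_enorm : continuous (@enorm R).
Proof.
move=> x; apply/cvgrPdist_lt => e e0; apply/nbhs_enormP; exists e => // y yx.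
apply: le_lt_trans yx; rewrite ler_norml; apply/andP; split.
  by rewrite lerNl opprB lerBlDr; have := enormD (y - x) x; rewrite subrK.
by rewrite enormB lerBlDr; have := enormD (x - y) y; rewrite subrK.
Qed.

End plane_geometry.

(** * Normals and curvature of convex sets *)

(** The vector [n] is an outer normal of any length. Asking for the closure instead of the boundary
    makes the condition closed in [n] and [x] and stable along segments of contact points; when [E]
    is open and [n] is nonzero, such an [x] is outside [E] anyway. *)
Definition supports {R : realType} (E : set (R * R)) (n x : R * R) : Prop :=
  closure E x /\ forall y, E y -> dotp (y - x) n <= 0.

Section local_geometry.
Context {R : realType}.
Implicit Types (x y z n tau nu : R * R) (E A : set (R * R)) (u : R -> R).

Lemma is_derive_approx u (t l e : R) : is_derive t (1 : R) u l -> 0 < e ->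
  exists2 d : R, 0 < d &
    forall s, `|s - t| < d -> `|u s - u t - l * (s - t)| <= e * `|s - t|.
Proof.
move=> [du ul] e0; have := du.
rewrite /derivable => /cvgrPdist_le/(_ e e0) H.
have {H} : \forall h \near 0^', `|l - h^-1 *: (u (h *: 1 + t) - u t)| <= e.
  by move: H; rewrite -ul /derive.
move=> /nbhs_ballP[d /= d0 dP].
exists d => // s st; have [->|sNt] := eqVneq s t.
  by rewrite !subrr mulr0 subr0 normr0 mulr0.
have st0 : s - t != 0 by rewrite subr_eq0.
have := dP (s - t); rewrite /ball /= sub0r normrN => /(_ st st0).
rewrite /GRing.scale /= mulr1 subrK.
move=> le; have -> : u s - u t - l * (s - t)
    = - (l - (s - t)^-1 * (u s - u t)) * (s - t).
  by rewrite mulNr mulrBl mulrAC mulVf// mul1r opprB.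
by rewrite normrM normrN ler_wpM2r.
Qed.

Lemma orthonormal_sqr tau nu x : dotp tau tau = 1 -> dotp nu nu = 1 ->
  dotp tau nu = 0 -> dotp x x = dotp x tau ^+ 2 + dotp x nu ^+ 2.
Proof.
move=> tt nn tn; have := orthonormal_expand x tt nn tn.
move: (dotp x tau) (dotp x nu) => a b ->.
rewrite dotpDl !dotpZl !(dotpC _ (_ + _)) !dotpDl !dotpZl tt nn tn.
by rewrite [dotp nu tau]dotpC tn; ring.
Qed.

(** The support condition makes the scalar product with [n] maximal at [y] along the graph of [u],
    so its derivative a + u' b vanishes, where a and b are the components of [n]; moreover b > 0.
    Hence the quantity differentiated in [is_curvature] is, up to sign, the sine of the normal
    angle. *)
Lemma supports_normal E x tau nu u : open E -> C11_subgraph_at E x tau nu u ->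
  exists2 d : R, 0 < d & forall y n, n != 0 -> supports E n y ->
    enorm (y - x) < d ->
    dotp (y - x) nu = u (dotp (y - x) tau) /\
    derive1 u (dotp (y - x) tau) /
      Num.sqrt (1 + derive1 u (dotp (y - x) tau) ^+ 2)
      = - (dotp n tau / enorm n).
Proof.
move=> oE [tt nn tn [d0 d0_gt0 [du _]] /nbhs_enormP[d1 d1_gt0 dE]].
exists (Num.min d0 d1); first by rewrite lt_min d0_gt0.
move=> y n n0 [cy sy]; rewrite lt_min => /andP[yd0 yd1].
set s := dotp (y - x) tau; set v := dotp (y - x) nu.
have etau : enorm tau = 1 by rewrite /enorm tt sqrtr1.
have enu : enorm nu = 1 by rewrite /enorm nn sqrtr1.
have sd0 : `|s| < d0 by apply: le_lt_trans yd0; exact: normr_dotp_le.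
have derS t : `|t| < d0 -> derivable u t 1.
  by move=> td; apply: du; rewrite in_itv /= -ltr_norml.
have conS t : `|t| < d0 -> {for t, continuous u}.
  by move=> /derS /derivable1_diffP; exact: differentiable_continuous.
have nEy : ~ E y.
  move=> /(open_enormP oE)[e e0 eE].
  have en : 0 < enorm n by exact: enorm_gt0.
  have c0 : 0 < e / 2 / enorm n by rewrite !divr_gt0.
  have /eE/sy : enorm (y + (e / 2 / enorm n) *: n - y) < e.
    rewrite addrC addKr enormZ gtr0_norm// divfK ?gt_eqF//.
    by rewrite ltr_pdivrMr// ltr_pMr// ltr1n.
  rewrite addrC addKr dotpZl -sqr_enorm leNgt => /negP; apply.
  by rewrite mulr_gt0// exprn_gt0.
have uv : u s <= v.
  by rewrite leNgt; apply/negP => vu; apply: nEy; apply/dE.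
have cu := conS _ sd0.
have vu : v <= u s.
  rewrite leNgt; apply/negP => uv'.
  have g0 : 0 < (v - u s) / 2 by rewrite divr_gt0// subr_gt0.
  move: cu => /cvgrPdist_lt/(_ _ g0)/nbhs_ballP[e /= e0 eP].
  have m0 : 0 < Num.min (d1 - enorm (y - x)) (Num.min e ((v - u s) / 2)).
    by rewrite !lt_min subr_gt0 yd1 e0.
  have /closure_enormP/(_ _ m0)[z Ez] := cy.
  rewrite !lt_min => /and3P[z1 z2 z3].
  have /dE zE : enorm (z - x) < d1.
    by rewrite (le_lt_trans (enorm_dist _ y _))// addrC -ltrBrDl.
  have zu := zE.1 Ez.
  have zxE : z - x = (y - x) + (z - y) by rewrite [RHS]addrC [RHS]addrA subrK.
  have zsE : dotp (z - x) tau = s + dotp (z - y) tau.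
    by rewrite zxE dotpDl.
  have zvE : dotp (z - x) nu = v + dotp (z - y) nu.
    by rewrite zxE dotpDl.
  have := eP (dotp (z - x) tau); rewrite /ball /= distrC zsE [s + _]addrC addrK.
  move=> /(_ (le_lt_trans (normr_dotp_le _ etau) z2)).
  have := le_lt_trans (normr_dotp_le _ enu) z3.
  move: zu; rewrite zsE zvE [_ + s]addrC => + /ltr_normlP[w1 w2] /ltr_normlP[w3 w4].
  by move: w1 w2 w3 w4; lra.
have {}uv : v = u s by apply/eqP; rewrite eq_le vu uv.
split => //.
pose a := dotp n tau; pose b := dotp n nu.
have nE : n = a *: tau + b *: nu by exact: orthonormal_expand.
(* The point at abscissa s + e lying eta below the graph belongs to [E]. It is tested against [n],
   and letting eta tend to 0 gives the inequality on the graph itself. *)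
have bump (e eta : R) : 0 < eta -> enorm (y - x) + `|e| + `|u (s + e) - u s - eta| < d1 ->
    e * a + (u (s + e) - u s - eta) * b <= 0.
  move=> eta0 de.
  pose z := y + (e *: tau + (u (s + e) - u s - eta) *: nu).
  have zy : z - y = e *: tau + (u (s + e) - u s - eta) *: nu.
    by rewrite /z addrC addKr.
  have zx : z - x = (y - x) + (e *: tau + (u (s + e) - u s - eta) *: nu).
    by rewrite /z addrAC.
  have zd : enorm (z - x) < d1.
    apply: le_lt_trans de; rewrite zx -[leRHS]addrA (le_trans (enormD _ _))// lerD2l.
    by rewrite (le_trans (enormD _ _))// !enormZ etau enu !mulr1.
  have Ez : E z.
    apply/(dE _ zd); rewrite zx !(dotpDl (y - x)) !(dotpDl (_ *: _)) !dotpZl tt nn tn [dotp nu tau]dotpC tn.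
    rewrite -/s -/v uv !mulr0 !mulr1 add0r addr0.
    by lra.
  by have := sy z Ez; rewrite zy dotpDl !dotpZl ![dotp _ n]dotpC.
have bump0 : exists2 e0 : R, 0 < e0 & forall e, `|e| < e0 ->
    `|s + e| < d0 /\ e * a + (u (s + e) - u s) * b <= 0.
  have g0 : 0 < (d1 - enorm (y - x)) / 3 by rewrite divr_gt0// subr_gt0.
  move: cu => /cvgrPdist_lt/(_ _ g0)/nbhs_ballP[e1 /= e10 eP].
  exists (Num.min e1 (Num.min ((d1 - enorm (y - x)) / 3) (d0 - `|s|))).
    by rewrite !lt_min e10 g0 subr_gt0.
  move=> e; rewrite !lt_min => /and3P[ee1 ee2 ee3]; split.
    by rewrite (le_lt_trans (ler_normD _ _))// -ltrBrDl.
  have := eP (s + e); rewrite /ball /= opprD addrA subrr sub0r normrN => /(_ ee1).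
  rewrite distrC => due.
  apply/ler_addgt0Pr => e2 e20.
  pose eta := Num.min ((d1 - enorm (y - x)) / 3) (e2 / (1 + `|b|)).
  have b10 : 0 < 1 + `|b| by rewrite ltr_pwDl.
  have eta0 : 0 < eta by rewrite lt_min g0 divr_gt0.
  have := bump e eta eta0.
  have eta1 : eta <= (d1 - enorm (y - x)) / 3 by rewrite ge_min lexx.
  have eta2 : eta * (1 + `|b|) <= e2 by rewrite -ler_pdivlMr// ge_min lexx orbT.
  have lt1 : enorm (y - x) + `|e| + `|u (s + e) - u s - eta| < d1.
    have := ler_normB (u (s + e) - u s) eta; rewrite (gtr0_norm eta0).
    by move: due ee2 eta1; lra.
  move=> /(_ lt1).
  have : eta * b <= eta * (1 + `|b|).
    by rewrite ler_pM2l// (le_trans (ler_norm _))// lerDr.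
  by move: eta2; lra.
have [e0 e00 {}bump0] := bump0.
have ab : a + derive1 u s * b = 0.
  pose F t := t * a + u t * b.
  have Fder t : t \in `]s - e0, s + e0[ -> derivable F t 1.
    rewrite in_itv /= => /andP[t1 t2].
    have : `|t - s| < e0 by rewrite ltr_norml; move: t1 t2; lra.
    move=> /bump0[]; rewrite addrC subrK => td _.
    by apply: derivableD; apply: derivableM => //; exact: derS.
  have := @derive1_at_max _ F (s - e0) (s + e0) s.
  have h1 : s - e0 <= s + e0 by lra.
  have h2 : s \in `]s - e0, s + e0[ by rewrite in_itv /=; apply/andP; split; lra.
  move=> /(_ h1 Fder h2) [].
    move=> t; rewrite in_itv /= => /andP[t1 t2].
    have : `|t - s| < e0 by rewrite ltr_norml; move: t1 t2; lra.
    move=> /bump0[_]; rewrite [s + _]addrC subrK /F; lra.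
  have us : is_derive s (1 : R) u (derive1 u s).
    by rewrite derive1E; apply/derivableP; exact: derS.
  have : is_derive s (1 : R) F (a + derive1 u s * b).
    rewrite /F; apply: is_deriveD.
      by apply: is_derive_eq; rewrite /GRing.scale /=; ring.
    by apply: is_derive_eq; rewrite /GRing.scale /=; ring.
  by move=> [_ <-] _ ->.
(* A point straight below [y] gives b >= 0, and b = 0 would force a = 0, hence [n] = 0. *)
have b0 : 0 < b.
  have b_ge0 : 0 <= b.
    have eta0 : 0 < (d1 - enorm (y - x)) / 2 by rewrite divr_gt0// subr_gt0.
    have := bump 0 _ eta0; rewrite normr0 !addr0 subrr sub0r normrN gtr0_norm//.
    rewrite mul0r add0r mulNr oppr_le0 pmulr_rge0//; apply.
    by move: eta0; lra.
  rewrite lt_neqAle b_ge0 andbT eq_sym; apply: contra n0 => /eqP b0.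
  move: ab; rewrite b0 mulr0 addr0 => a0.
  by rewrite nE a0 b0 !scale0r addr0.
have p1 : 0 < 1 + derive1 u s ^+ 2 by rewrite ltr_pwDl ?sqr_ge0.
have -> : enorm n = b * Num.sqrt (1 + derive1 u s ^+ 2).
  rewrite /enorm (orthonormal_sqr n tt nn tn) -/a -/b.
  have -> : a = - (derive1 u s * b) by apply/eqP; rewrite -addr_eq0 ab.
  rewrite -[in RHS](gtr0_norm b0) -sqrtr_sqr -sqrtrM ?sqr_ge0//.
  by congr Num.sqrt; ring.
rewrite -/a; have -> : a = - (derive1 u s * b) by apply/eqP; rewrite -addr_eq0 ab.
have sp0 : Num.sqrt (1 + derive1 u s ^+ 2) != 0 by rewrite gt_eqF// sqrtr_gt0.
by field; rewrite sp0 gt_eqF.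
Qed.

Lemma supports_convex E n x y (t : R) : convex_set E -> 0 <= t -> t <= 1 ->
  supports E n x -> supports E n y -> supports E n (x + t *: (y - x)).
Proof.
move=> cE t0 t1 [cx sx] [cy sy]; split; last first.
  move=> z Ez.
  have -> : dotp (z - (x + t *: (y - x))) n
    = (1 - t) * dotp (z - x) n + t * dotp (z - y) n.
    by rewrite /dotp /= /GRing.scale /=; ring.
  have := mulr_ge0_le0 t0 (sy z Ez).
  have t1' : 0 <= 1 - t by rewrite subr_ge0.
  have := mulr_ge0_le0 t1' (sx z Ez); lra.
apply/closure_enormP => d d0.
move/closure_enormP/(_ d d0) : cx => [x' Ex' xx'].
move/closure_enormP/(_ d d0) : cy => [y' Ey' yy'].
exists (x' + t *: (y' - x')); first exact: convex_setP.
have -> : x' + t *: (y' - x') - (x + t *: (y - x))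
  = (1 - t) *: (x' - x) + t *: (y' - y).
  by apply/eqP; rewrite -subr_eq0; apply/eqP; congr pair; rewrite /= /GRing.scale /=; ring.
rewrite (le_lt_trans (enormD _ _))// !enormZ !ger0_norm ?subr_ge0//.
move: t0; rewrite le_eqVlt => /orP[/eqP<-|t0].
  by rewrite subr0 mul1r mul0r addr0.
have : (1 - t) * enorm (x' - x) <= (1 - t) * d.
  by rewrite ler_wpM2l ?subr_ge0// ltW.
have : t * enorm (y' - y) < t * d by rewrite ltr_pM2l.
lra.
Qed.

(** A point [y] of [E] strictly above the tangent line would force [E] above the graph near [x]: the
    segment towards [y] leaves the tangent at a linear rate, while the graph deviates from it only
    to higher order. As [x] is not in [E], the segment starts at a nearby point [x'] of [E]. *)
Lemma supports_subgraph E x tau nu u : convex_set E -> boundary E x -> open E ->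
  C11_subgraph_at E x tau nu u -> supports E (nu - derive1 u 0 *: tau) x.
Proof.
move=> cE bx oE H; split; first by case: bx.
have [tt nn tn [d0 d0_gt0 [du _]] /nbhs_enormP[d1 d1_gt0 dE]] := H.
move=> y Ey; set p := derive1 u 0.
have pE : is_derive (0 : R) (1 : R) u p.
  rewrite /p derive1E; apply/derivableP; apply: du.
  by rewrite in_itv /= oppr_lt0 d0_gt0.
have u0 : u 0 <= 0.
  have : ~ E x by case: bx => _; rewrite (interior_id E).1.
  rewrite leNgt => nEx; apply/negP => u0; apply: nEx; apply/dE.
    by rewrite subrr enorm0.
  by rewrite subrr /dotp /= !mul0r addr0.
set s := dotp (y - x) tau; set v := dotp (y - x) nu.
have -> : dotp (y - x) (nu - p *: tau) = v - p * s.
  by rewrite /v /s /dotp /= /GRing.scale /=; ring.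
have etau : enorm tau = 1 by rewrite /enorm tt sqrtr1.
have enu : enorm nu = 1 by rewrite /enorm nn sqrtr1.
rewrite leNgt; apply/negP => g0; set g := v - p * s in g0.
have s1 : 0 < 1 + `|s| by rewrite ltr_pwDl.
(* Half of the excess [g] pays for the deviation of the graph from its tangent. The other half pays,
   through the choice of [eta], for starting at [x'] instead of [x], an error of at most eta (|p| +
   1 + e). *)
pose e := g / 2 / (1 + `|s|).
have e0 : 0 < e by rewrite !divr_gt0.
have es : e * `|s| <= g / 2.
  by rewrite /e mulrAC ler_pdivrMr// ler_pM2l ?divr_gt0// lerDr.
have [d2 d2_gt0 ud] := is_derive_approx pE e0.
pose m := Num.min d1 d2.
have m0 : 0 < m by rewrite lt_min d1_gt0.
have q1 : 0 < 1 + enorm (y - x) by rewrite ltr_pwDl ?enorm_ge0.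
pose l := Num.min 1 (m / 2 / (1 + enorm (y - x))).
have l0 : 0 < l by rewrite lt_min ltr01 !divr_gt0.
have l1 : l <= 1 by rewrite ge_min lexx.
have lm : l * enorm (y - x) <= m / 2.
  rewrite (@le_trans _ _ (l * (1 + enorm (y - x))))//.
    by rewrite ler_pM2l// lerDr.
  by rewrite -ler_pdivlMr// ge_min lexx orbT.
have r0 : 0 < `|p| + 1 + e by rewrite addr_gt0// ltr_wpDl.
pose eta := Num.min (m / 2) (l * (g / 2) / (`|p| + 1 + e)).
have eta0 : 0 < eta by rewrite lt_min !divr_gt0// mulr_gt0// divr_gt0.
have etam : eta <= m / 2 by rewrite ge_min lexx.
have etal : eta * (`|p| + 1 + e) <= l * (g / 2).
  by rewrite -ler_pdivlMr// ge_min lexx orbT.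
have [cx _] := bx; move/closure_enormP/(_ _ eta0) : cx => [x' Ex' xx'].
have Ez := convex_setP cE (ltW l0) l1 Ex' Ey.
set z := (x' + _) in Ez.
have zx : z - x = l *: (y - x) + (1 - l) *: (x' - x).
  by congr pair; rewrite /= /GRing.scale /=; ring.
have ll : 0 <= 1 - l by rewrite subr_ge0.
have lw : (1 - l) * enorm (x' - x) < eta.
  apply: le_lt_trans xx'; rewrite ler_piMl ?enorm_ge0//.
  by rewrite lerBlDr lerDl ltW.
have zd : enorm (z - x) < m.
  rewrite zx (le_lt_trans (enormD _ _))// !enormZ (gtr0_norm l0) ger0_norm//.
  by move: lm lw etam; lra.
have zd1 : enorm (z - x) < d1 by apply: lt_le_trans zd _; rewrite ge_min lexx.
have zd2 : enorm (z - x) < d2 by apply: lt_le_trans zd _; rewrite ge_min lexx orbT.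
have := (dE _ zd1).1 Ez.
have := ud (dotp (z - x) tau); rewrite !subr0.
move=> /(_ (le_lt_trans (normr_dotp_le _ etau) zd2)) /ler_normlP[_].
rewrite zx !(dotpDl (_ *: _)) !dotpZl -/s -/v.
set a := dotp (x' - x) tau; set b := dotp (x' - x) nu.
have := ler_normD (l * s) ((1 - l) * a); rewrite !normrM (gtr0_norm l0) (ger0_norm ll).
set A := `|_ + _|.
have a1 : (1 - l) * `|a| < eta.
  by rewrite (le_lt_trans _ lw)// ler_wpM2l// normr_dotp_le.
have b1 : (1 - l) * `|b| < eta.
  by rewrite (le_lt_trans _ lw)// ler_wpM2l// normr_dotp_le.
move=> h1 h2 h3.
have h4 : e * A <= e * (l * `|s| + eta).
  by rewrite ler_pM2l// (le_trans h1)// lerD2l ltW.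
have h5 : p * ((1 - l) * a) <= `|p| * eta.
  rewrite (le_trans (ler_norm _))// normrM ler_wpM2l// normrM (ger0_norm ll).
  exact: ltW.
have h6 : - ((1 - l) * b) <= eta.
  rewrite (le_trans (ler_norm _))// normrN normrM (ger0_norm ll).
  exact: ltW.
have h7 : l * (e * `|s|) <= l * (g / 2) by rewrite ler_pM2l.
have h8 : l * v = l * g + l * (p * s) by rewrite /g; ring.
move: h8 h2 h3 h4 h5 h6 h7 etal u0; lra.
Qed.

(** Two contact points of one supporting line span a segment of contact points. Along it the sine of
    the normal angle is constant by [supports_normal], so its derivative - h at [x] would vanish. *)
Lemma curvature_supports_unique E x y n (h : R) : convex_set E -> open E ->
  is_curvature E x h -> h != 0 -> n != 0 -> supports E n x -> supports E n y ->
  y = x.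
Proof.
move=> cE oE [tau [nu [u [H psi]]]] h0 n0 sx sy.
have [d d0 dP] := supports_normal oE H.
have [tt nn tn _ _] := H.
set s := dotp (y - x) tau.
have q1 : 0 < 1 + enorm (y - x) by rewrite ltr_pwDl ?enorm_ge0.
pose l0 := Num.min 1 (d / (1 + enorm (y - x))).
have l00 : 0 < l0 by rewrite lt_min ltr01 divr_gt0.
have lP l : 0 <= l -> l < l0 -> l * dotp (y - x) nu = u (l * s) /\
    derive1 u (l * s) / Num.sqrt (1 + derive1 u (l * s) ^+ 2)
      = - (dotp n tau / enorm n).
  move=> lge0; rewrite lt_min => /andP[l1 ld].
  have := dP (x + l *: (y - x)) n n0 (supports_convex cE lge0 (ltW l1) sx sy).
  rewrite [x + _]addrC addrK !dotpZl; apply.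
  rewrite enormZ ger0_norm//.
  rewrite (@le_lt_trans _ _ (l * (1 + enorm (y - x))))//.
    by rewrite ler_wpM2l// lerDr.
  by rewrite -ltr_pdivlMr.
(* If the segment is vertical in the local frame, all its points near [x] have the ordinate u(0), so
   it reduces to a point. *)
have [sz|s0] := eqVneq s 0.
  have := (lP 0 (lexx _) l00).1; rewrite !mul0r => u00.
  have l2 : 0 < l0 / 2 by rewrite divr_gt0.
  have l2' : l0 / 2 < l0 by move: l00; lra.
  have [+ _] := lP (l0 / 2) (ltW l2) l2'.
  rewrite sz mulr0 -u00 => /eqP; rewrite mulf_eq0 (gt_eqF l2) /= => /eqP v0.
  have := orthonormal_expand (y - x) tt nn tn.
  by rewrite -/s sz v0 !scale0r addr0 => /subr0_eq.
exfalso.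
have e0 : 0 < `|h| / 2 by rewrite divr_gt0// normr_gt0.
have [d2 d20 ud] := is_derive_approx psi e0.
have s1 : 0 < `|s| by rewrite normr_gt0.
pose l := Num.min (l0 / 2) (d2 / 2 / `|s|).
have lgt0 : 0 < l by rewrite lt_min !divr_gt0.
have ll0 : l < l0.
  by rewrite /l gt_min; apply/orP; left; move: l00; lra.
have ls : `|l * s| < d2.
  rewrite normrM gtr0_norm// (@le_lt_trans _ _ (d2 / 2))//; last first.
    by move: d20; lra.
  by rewrite -ler_pdivlMr// ge_min lexx orbT.
have := ud (l * s); rewrite !subr0 => /(_ ls).
rewrite (lP l (ltW lgt0) ll0).2.
have := (lP 0 (lexx _) l00).2; rewrite mul0r => ->.
rewrite subrr sub0r normrN normrM normrN.
have lspos : 0 < `|l * s| by rewrite normrM mulr_gt0// normr_gt0 gt_eqF.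
rewrite ler_pM2r//; have : 0 < `|h| by rewrite normr_gt0.
by lra.
Qed.

End local_geometry.

(** * Slopes of normals *)

Section slope.
Context {R : realType}.
Implicit Types (x y z n tau nu : R * R) (E A : set (R * R)) (u : R -> R).

Definition slope_dir (sg m : R) : R * R := (sg, sg * m).

Lemma slope_dir_neq0 (sg m : R) : sg ^+ 2 = 1 -> slope_dir sg m != 0.
Proof.
move=> sg1; apply/eqP => -[sg0 _]; move: sg1; rewrite sg0 expr0n /= => /esym/eqP.
by rewrite oner_eq0.
Qed.

Lemma onem2_gt0 (m : R) : 0 < 1 + m ^+ 2.
Proof. by rewrite ltr_pwDl ?sqr_ge0. Qed.

Lemma enorm_slope_dir (sg m : R) : sg ^+ 2 = 1 ->
  enorm (slope_dir sg m) = Num.sqrt (1 + m ^+ 2).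
Proof.
move=> sg1; rewrite /enorm; congr Num.sqrt; rewrite /dotp /= -!expr2.
by rewrite exprMn sg1 mul1r.
Qed.

(** The quotient is the scalar product of (a, b) with the unit vector of slope t. Its derivative
    simplifies through q^2 - m^2 = 1, where q = sqrt (1 + m^2). *)
Lemma is_derive_slope_sine (a b m : R) :
  is_derive m (1 : R) (fun t => (a + t * b) / Num.sqrt (1 + t ^+ 2))
    ((b - m * a) / (Num.sqrt (1 + m ^+ 2)) ^+ 3).
Proof.
have m0 := onem2_gt0 m.
have q0 : Num.sqrt (1 + m ^+ 2) != 0 by rewrite gt_eqF// sqrtr_gt0.
have ds : is_derive m (1 : R) (fun t : R => 1 + t ^+ 2) (m *+ 2).
  by apply: is_derive_eq; rewrite /GRing.scale /=; ring.
have dsq : is_derive (1 + m ^+ 2) (1 : R) Num.sqrt (2 * Num.sqrt (1 + m ^+ 2))^-1.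
  exact: is_derive1_sqrt.
have dc : is_derive m (1 : R) (fun t : R => Num.sqrt (1 + t ^+ 2))
     ((2 * Num.sqrt (1 + m ^+ 2))^-1 * (m *+ 2)).
  exact: (@is_derive1_comp _ Num.sqrt (fun t : R => 1 + t ^+ 2)).
have dn : is_derive m (1 : R) (fun t : R => a + t * b) b.
  by apply: is_derive_eq; rewrite /GRing.scale /=; ring.
have dv := @is_deriveV _ _ m _ 1 q0 dc.
have := is_deriveM dn dv.
move=> H; apply: is_derive_eq H _.
have q2 : Num.sqrt (1 + m ^+ 2) ^+ 2 - m ^+ 2 = 1.
  by rewrite sqr_sqrtr ?ltW// addrK.
move: (Num.sqrt _) q0 q2 => q q0 q2.
rewrite /GRing.scale /=.
transitivity ((b * (q ^+ 2 - m ^+ 2) - m * a) / q ^+ 3); first by field.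
by rewrite q2 mulr1.
Qed.

(* The sine <(1, m), tau> / |(1, m)| of the normal angle equals, up to sign,
   u' / sqrt (1 + u'^2), whose derivative at 0 is -h. Continuity of the Gauss map
   is not needed: the bound is trivial when m' is not close to m. *)
Lemma curvature_slope E x (sg m h a : R) : open E -> is_curvature E x h ->
  sg ^+ 2 = 1 -> 0 < a -> a < h * (1 + m ^+ 2) -> supports E (slope_dir sg m) x ->
  exists2 d : R, 0 < d & forall y m', supports E (slope_dir sg m') y ->
    enorm (y - x) < d -> a * enorm (y - x) <= `|m' - m|.
Proof.
move=> oE [tau [nu [u [H psi]]]] sg1 a0 ah sx.
have [d1 d10 dP] := supports_normal oE H.
have [tt nn tn [d2 d20 [du _]] _] := H.
set p := derive1 u 0 in psi *.
pose S m' := (tau.1 + m' * tau.2) / Num.sqrt (1 + m' ^+ 2).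
have sgn0 : sg != 0 by rewrite -sqrf_eq0 sg1 oner_eq0.
have sgS m' : dotp (slope_dir sg m') tau / enorm (slope_dir sg m') = sg * S m'.
  rewrite enorm_slope_dir// /S mulrA; congr (_ / _).
  by rewrite /dotp /=; ring.
have psi0 : p / Num.sqrt (1 + p ^+ 2) = - (sg * S m).
  have := dP x _ (slope_dir_neq0 m sg1) sx; rewrite subrr enorm0 => /(_ d10)[_].
  by rewrite sgS {1 2}/dotp /= !mul0r addr0.
have u0 : u 0 = 0.
  have := dP x _ (slope_dir_neq0 m sg1) sx; rewrite subrr enorm0 => /(_ d10)[+ _].
  by rewrite /dotp /= !mul0r addr0 => <-.
have m2 := onem2_gt0 m; have p2 := onem2_gt0 p.
set q := Num.sqrt (1 + m ^+ 2) in psi0 *.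
have q0 : 0 < q by rewrite sqrtr_gt0.
have qq : q ^+ 2 = 1 + m ^+ 2 by rewrite sqr_sqrtr// ltW.
set P := Num.sqrt (1 + p ^+ 2) in psi0.
have P0 : 0 < P by rewrite sqrtr_gt0.
have PP : P ^+ 2 = 1 + p ^+ 2 by rewrite sqr_sqrtr// ltW.
have dS := is_derive_slope_sine tau.1 tau.2 m; rewrite -/q in dS.
set D := (_ / q ^+ 3) in dS.
(* [|D|] is the angular speed 1 / (1 + m^2) times the cosine of the angle between the normal and
   [nu], and [P] is the inverse of that cosine. *)
have DP : `|D| * P * (1 + m ^+ 2) = 1.
  apply/eqP; rewrite -(@eqrXn2 _ 2)//; last first.
    by rewrite !mulr_ge0// ltW.
  have tauE : (tau.2 - m * tau.1) ^+ 2 = q ^+ 2 - (tau.1 + m * tau.2) ^+ 2.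
    rewrite qq; transitivity ((1 + m ^+ 2) * dotp tau tau - (tau.1 + m * tau.2) ^+ 2).
      by rewrite /dotp; ring.
    by rewrite tt mulr1.
  have SP : (tau.1 + m * tau.2) ^+ 2 * P ^+ 2 = p ^+ 2 * q ^+ 2.
    have : (p / P) ^+ 2 = (S m) ^+ 2 by rewrite psi0 sqrrN exprMn sg1 mul1r.
    have P2 : P ^+ 2 != 0 by rewrite expf_neq0// gt_eqF.
    have q2 : q ^+ 2 != 0 by rewrite expf_neq0// gt_eqF.
    by rewrite /S -/q !expr_div_n => /eqP; rewrite eqr_div// => /eqP.
  have K : (tau.2 - m * tau.1) ^+ 2 * P ^+ 2 = q ^+ 2.
    by rewrite tauE mulrBl SP PP; ring.
  rewrite -qq expr1n 2!exprMn real_normK ?num_real// /D expr_div_n.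
  rewrite [X in X * _ == 1]mulrAC K; apply/eqP.
  by field; rewrite gt_eqF.
have absD : 0 <= `|D| by [].
have K0 : 0 < a * (`|D| + P + 1) + 1.
  by rewrite ltr_wpDl// mulr_ge0 ?(ltW a0)// !addr_ge0// ltW.
have gap : 0 < h - a * (`|D| * P).
  rewrite subr_gt0 -(ltr_pM2r m2); apply: le_lt_trans ah.
  by rewrite -mulrA DP mulr1.
(* One tolerance for three first-order approximations. As a |D| P < h, a small e still satisfies a
   (P + e) (|D| + e) <= h - e; the bound e <= 1 lets e^2 be replaced by e. *)
pose e := Num.min 1 ((h - a * (`|D| * P)) / (a * (`|D| + P + 1) + 1)).
have e0 : 0 < e by rewrite lt_min ltr01 divr_gt0.
have e1 : e <= 1 by rewrite ge_min lexx.
have eK : e * (a * (`|D| + P + 1) + 1) <= h - a * (`|D| * P).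
  by rewrite -ler_pdivlMr// ge_min lexx orbT.
have eP : a * (P + e) * (`|D| + e) <= h - e.
  have : e * e <= e by rewrite ler_piMl// ltW.
  rewrite -(ler_pM2l a0) => e2.
  have -> : a * (P + e) * (`|D| + e)
    = a * (`|D| * P) + e * (a * (`|D| + P)) + a * (e * e) by ring.
  by move: eK e2; rewrite mulrDr mulr1 mulrDr mulr1 mulrDr; lra.
have [eta eta0 etaP] := is_derive_approx dS e0.
have [d3 d30 psiP] := is_derive_approx psi e0.
have pE : is_derive (0 : R) (1 : R) u p.
  rewrite /p derive1E; apply/derivableP; apply: du.
  by rewrite in_itv /= oppr_lt0 d20.
have [d4 d40 uP] := is_derive_approx pE e0.
have etau : enorm tau = 1 by rewrite /enorm tt sqrtr1.
have enu : enorm nu = 1 by rewrite /enorm nn sqrtr1.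
exists (Num.min (Num.min d1 (eta / a)) (Num.min d3 d4)).
  by rewrite !lt_min d10 divr_gt0// d30.
move=> y m' sy; rewrite !lt_min => /andP[/andP[y1 y2] /andP[y3 y4]].
have [lt_eta|] := ltP `|m' - m| eta; last first.
  by apply: le_trans; rewrite mulrC -ler_pdivlMr// ltW.
have [yu ypsi] := dP y _ (slope_dir_neq0 m' sg1) sy y1.
set s := dotp (y - x) tau in yu ypsi.
have sy_le : `|s| <= enorm (y - x) by exact: normr_dotp_le.
(* Three estimates are chained: |y - x| <= (P + e) |s|, then (h - e) |s| <= |S m' - S m|, then |S m'
   - S m| <= (|D| + e) |m' - m|. *)
have yx : enorm (y - x) <= (P + e) * `|s|.
  have -> : y - x = s *: (tau + p *: nu) + (u s - p * s) *: nu.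
    rewrite [LHS](orthonormal_expand _ tt nn tn) -/s yu.
    by congr pair; rewrite /= /GRing.scale /=; ring.
  rewrite (le_trans (enormD _ _))// !enormZ enu mulr1 mulrDl; apply: lerD.
    rewrite mulrC ler_wpM2r// /enorm /P ler_wsqrtr//.
    rewrite (orthonormal_sqr _ tt nn tn) !dotpDl !dotpZl tt nn tn.
    by rewrite [dotp nu tau]dotpC tn !mulr0 addr0 mulr1 add0r expr1n.
  have := uP s; rewrite u0 !subr0; apply.
  exact: le_lt_trans y4.
have psis : (h - e) * `|s| <= `|S m' - S m|.
  have := psiP s; rewrite !subr0 => /(_ (le_lt_trans sy_le y3)).
  rewrite ypsi -/p -/P psi0 sgS => H1.
  have : `|h * s| <= `|S m' - S m| + e * `|s|.
    have -> : h * s = sg * (S m' - S m) + ((- (sg * S m') - - (sg * S m)) - - h * s).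
      by ring.
    rewrite (le_trans (ler_normD _ _))// lerD// normrM.
    have /eqP : `|sg| ^+ 2 = 1 by rewrite real_normK ?num_real.
    by rewrite sqrp_eq1// => /eqP ->; rewrite mul1r.
  rewrite normrM mulrBl lerBlDr; apply: le_trans.
  by rewrite ler_wpM2r// ler_norm.
have Sle : `|S m' - S m| <= (`|D| + e) * `|m' - m|.
  have := etaP m' lt_eta; rewrite -!/(S _) => H1.
  have -> : S m' - S m = D * (m' - m) + (S m' - S m - D * (m' - m)) by ring.
  by rewrite (le_trans (ler_normD _ _))// mulrDl normrM lerD.
have De : 0 < `|D| + e by rewrite ltr_wpDl.
rewrite -(ler_pM2l De) (le_trans _ Sle)// (le_trans _ psis)//.
rewrite (@le_trans _ _ (a * (P + e) * (`|D| + e) * `|s|))//; last by rewrite ler_wpM2r.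
have -> : a * (P + e) * (`|D| + e) * `|s| = (`|D| + e) * (a * ((P + e) * `|s|)) by ring.
by rewrite ler_pM2l// ler_pM2l.
Qed.

End slope.

(** * The disc: boundary, normals and curvature *)

Section ball.
Context {R : realType} (r : R).
Hypothesis r_gt0 : 0 < r.
Implicit Types (x y z n tau nu : R * R) (s t : R).

Lemma open_eball : open (eball r).
Proof.
rewrite openE => x; rewrite /eball /= => xr; apply/nbhs_enormP.
exists (r - enorm x); first by rewrite subr_gt0.
by move=> y yx /=; have := enormD (y - x) x; rewrite subrK; move: yx; lra.
Qed.

Lemma boundary_eball : boundary (eball r) = [set x | enorm x = r].
Proof.
rewrite boundary_openE; last exact: open_eball.
apply/seteqP; split=> x /=.
  rewrite /eball /= => -[/closure_enormP cx /negP]; rewrite -leNgt => rx.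
  apply/eqP; rewrite eq_le rx andbT; apply/ler_addgt0Pr => e e0.
  have [y yr yx] := cx e e0.
  by have := enormD (x - y) y; rewrite subrK enormB; move: yr yx; rewrite /=; lra.
move=> xr; split; last by rewrite /eball /= xr ltxx.
apply/closure_enormP => d d0.
pose e := Num.min (1 / 2) (d / (2 * r)).
have r2 : 0 < 2 * r by rewrite mulr_gt0.
have e0 : 0 < e by rewrite lt_min !divr_gt0.
have e1 : e <= 1 / 2 by rewrite ge_min lexx.
have e2 : e * (2 * r) <= d by rewrite -ler_pdivlMr// ge_min lexx orbT.
exists ((1 - e) *: x).
  rewrite /eball /= enormZ xr ger0_norm; last by lra.
  by rewrite gtr_pMl//; lra.
rewrite scalerBl scale1r addrC addKr enormN enormZ xr gtr0_norm//.
by have := mulr_gt0 e0 r_gt0; lra.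
Qed.

Lemma supports_eball x : enorm x = r -> supports (eball r) x x.
Proof.
move=> xr; split.
  by have [] : boundary (eball r) x by rewrite boundary_eball.
move=> y; rewrite /eball /= => yr.
rewrite dotpBl -sqr_enorm xr subr_le0 (le_trans (dotp_le _ _))// xr expr2.
by rewrite ler_pM2r// ltW.
Qed.

(** Upper half of the circle: in the frame with origin at a boundary point x and nu = x / r, the
    disc is locally the subgraph of g - r. *)
Let g s := Num.sqrt (r ^+ 2 - s ^+ 2).

Let g_gt0 s : `|s| < r -> 0 < g s.
Proof.
move=> sr; rewrite sqrtr_gt0 subr_gt0 -real_normK ?num_real//.
by rewrite ltr_pXn2r// ?nnegrE// ltW.
Qed.

Let gg s : `|s| < r -> g s ^+ 2 = r ^+ 2 - s ^+ 2.
Proof.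
move=> sr; rewrite sqr_sqrtr// subr_ge0 -real_normK ?num_real//.
by rewrite ler_pXn2r// ?nnegrE ltW.
Qed.

Let is_derive_g s : `|s| < r -> is_derive s (1 : R) (fun s => g s - r) (- (s / g s)).
Proof.
move=> sr; have g0 := g_gt0 sr.
have ds : is_derive s (1 : R) (fun t : R => r ^+ 2 - t ^+ 2) (- (s *+ 2)).
  by apply: is_derive_eq; rewrite /GRing.scale /=; ring.
have dsq : is_derive (r ^+ 2 - s ^+ 2) (1 : R) Num.sqrt (2 * g s)^-1.
  by apply: is_derive1_sqrt; rewrite -gg// exprn_gt0.
have dc : is_derive s (1 : R) g ((2 * g s)^-1 * (- (s *+ 2))).
  exact: (@is_derive1_comp _ Num.sqrt (fun t : R => r ^+ 2 - t ^+ 2)).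
apply: is_derive_eq (is_deriveB dc (is_derive_cst r s 1)) _.
by field; rewrite gt_eqF.
Qed.

Let derive1_g s : `|s| < r -> derive1 (fun s => g s - r) s = - (s / g s).
Proof. by move=> /is_derive_g[_]; rewrite derive1E. Qed.

(** For u = g - r and |s| < r the quotient u' / sqrt (1 + u'^2) is exactly - s / r. *)
Lemma is_curvature_eball x : enorm x = r -> is_curvature (eball r) x r^-1.
Proof.
move=> xr.
have x2 : dotp x x = r ^+ 2 by rewrite -sqr_enorm xr.
pose nu := r^-1 *: x; pose tau := r^-1 *: (- x.2, x.1).
have rn0 : r != 0 by rewrite gt_eqF.
have nn : dotp nu nu = 1.
  by rewrite dotpZl dotpC dotpZl x2; field.
have tt : dotp tau tau = 1.
  rewrite dotpZl dotpC dotpZl.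
  have -> : dotp (- x.2, x.1) (- x.2, x.1) = dotp x x by rewrite /dotp /=; ring.
  by rewrite x2; field.
have tn : dotp tau nu = 0.
  by rewrite dotpZl dotpC dotpZl /dotp /=; ring.
exists tau, nu, (fun s => g s - r); split; last first.
  apply: (@near_eq_is_derive _ _ _ (fun s => - r^-1 * s)); last first.
    by apply: is_derive_eq; rewrite /GRing.scale /=; ring.
  apply/nbhs_ballP; exists r => // s; rewrite /ball /= sub0r normrN => sr.
  rewrite derive1_g//.
  have g0 := g_gt0 sr; have gn0 : g s != 0 by rewrite gt_eqF.
  have -> : 1 + (- (s / g s)) ^+ 2 = (r / g s) ^+ 2.
    apply/eqP; rewrite sqrrN !expr_div_n -subr_eq0; apply/eqP.
    have : r ^+ 2 = g s ^+ 2 + s ^+ 2 by rewrite gg// subrK.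
    by move=> ->; field.
  rewrite sqrtr_sqr gtr0_norm ?divr_gt0//.
  by field; rewrite rn0 gn0.
split => //.
  exists (r / 2); first by rewrite divr_gt0.
  have small s : s \in `]- (r / 2), (r / 2)[ -> `|s| < r / 2.
    by rewrite in_itv /= -ltr_norml.
  have smallr s : s \in `]- (r / 2), (r / 2)[ -> `|s| < r.
    by move=> /small; move: r_gt0; lra.
  split; first by move=> s /smallr /is_derive_g[].
  (* For |s|, |t| < r / 2 the numerator of the difference of derivatives is at most (r + r / 2) |s -
     t| and the denominator g(s) g(t) at least r^2 / 4, whence 6 / r. *)
  apply: (@klipschitzW _ _ _ (6 / r)).
    apply: (@globally_properfilter _ _ (0, 0)).
    by split; rewrite /= in_itv /= oppr_lt0 !divr_gt0.
  move=> [s t] /= [/[dup] /small s2 /smallr sr /[dup] /small t2 /smallr tr].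
  rewrite !derive1_g//.
  have gs := g_gt0 sr; have gt := g_gt0 tr.
  have lower a : `|a| < r / 2 -> r / 2 <= g a.
    move=> ar; have ar' : `|a| < r by move: r_gt0 ar; lra.
    rewrite -(ler_pXn2r (ltn0Sn 1)) ?nnegrE ?divr_ge0 ?(ltW r_gt0) ?(ltW (g_gt0 ar'))//.
    rewrite gg// -[a ^+ 2]real_normK ?num_real//.
    have : `|a| ^+ 2 <= (r / 2) ^+ 2.
      by rewrite ler_pXn2r ?nnegrE ?divr_ge0 ?(ltW r_gt0)// ltW.
    have : 0 < r ^+ 2 by rewrite exprn_gt0.
    by rewrite expr_div_n; lra.
  have gst : `|g t - g s| <= `|s - t|.
    have gst0 : 0 < g s + g t by rewrite addr_gt0.
    rewrite -(ler_pM2r gst0) -{1}(gtr0_norm gst0) -normrM.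
    have -> : (g t - g s) * (g s + g t) = (s - t) * (s + t).
      transitivity (g t ^+ 2 - g s ^+ 2); first by ring.
      by rewrite !gg//; ring.
    rewrite normrM ler_wpM2l// (le_trans (ler_normD _ _))//.
    by have := lower _ s2; have := lower _ t2; move: s2 t2; lra.
  have -> : - (s / g s) - - (t / g t)
    = ((t - s) * g t + t * (g s - g t)) / (g s * g t).
    by field; rewrite !gt_eqF.
  have gp : 0 < g s * g t by rewrite mulr_gt0.
  have gp4 : r ^+ 2 / 4 <= g s * g t.
    have -> : r ^+ 2 / 4 = (r / 2) * (r / 2) by field.
    by rewrite ler_pM ?lower// divr_ge0// ltW.
  have gtr' : g t <= r.
    rewrite -(ler_pXn2r (ltn0Sn 1)) ?nnegrE ?(ltW gt) ?(ltW r_gt0)// gg//.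
    by have := sqr_ge0 t; lra.
  rewrite normrM normfV (gtr0_norm gp) ler_pdivrMr// (le_trans (ler_normD _ _))//.
  rewrite !normrM (gtr0_norm gt) (distrC t s) (distrC (g s)).
  apply: (@le_trans _ _ (`|s - t| * (3 / 2 * r))).
    have := ler_wpM2l (normr_ge0 (s - t)) gtr'.
    have : `|t| * `|g t - g s| <= (r / 2) * `|s - t|.
      by rewrite ler_pM// ltW.
    lra.
  have -> : `|s - t| * (3 / 2 * r) = 6 / r * `|s - t| * (r ^+ 2 / 4) by field.
  by rewrite ler_wpM2l// mulr_ge0// divr_ge0// ltW.
apply/nbhs_enormP; exists (r / 2); first by rewrite divr_gt0.
move=> y yx.
have s_le n : dotp n n = 1 -> `|dotp (y - x) n| <= enorm (y - x).
  by move=> n1; apply: normr_dotp_le; rewrite /enorm n1 sqrtr1.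
have sr := le_lt_trans (s_le _ tt) yx; have vr := le_lt_trans (s_le _ nn) yx.
set s := dotp (y - x) tau in sr *; set v := dotp (y - x) nu in vr *.
have sr' : `|s| < r by move: sr r_gt0; lra.
have yE : y = s *: tau + (v + r) *: nu.
  rewrite [(v + r) *: nu]scalerDl addrA -(orthonormal_expand _ tt nn tn) /nu scalerA divff//.
  by rewrite scale1r subrK.
clearbody s v tau nu.
have y2 : enorm y ^+ 2 = s ^+ 2 + (v + r) ^+ 2.
  rewrite sqr_enorm (orthonormal_sqr y tt nn tn) {1 2}yE !dotpDl !dotpZl tt nn tn.
  by rewrite (dotpC nu tau) tn !mulr0 !mulr1 addr0 add0r.
have vr0 : 0 < v + r by move: vr r_gt0 => /ltr_normlP[]; lra.
rewrite /eball /= ltrBrDr -(ltr_pXn2r (ltn0Sn 1)) ?nnegrE ?enorm_ge0 ?(ltW r_gt0)//.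
rewrite -[X in _ <-> is_true X](ltr_pXn2r (ltn0Sn 1)) ?nnegrE ?(ltW vr0) ?(ltW (g_gt0 sr'))//.
by rewrite gg// y2 ltrBrDl.
Qed.

(** Since [curvature] picks some [h], every representation has to give 1 / r. At a point y of the
    circle the normal is y itself, so [supports_normal] makes the difference quotient between x and
    y exactly - 1 / r; a single y close to x suffices for each error [e]. *)
Lemma curvature_eball x : enorm x = r -> curvature (eball r) x = r^-1.
Proof.
move=> xr; apply: xget_unique; first exact: is_curvature_eball.
move=> h [tau [nu [u [H psi]]]].
have [d d0 dP] := supports_normal open_eball H.
have [tt nn tn _ _] := H.
have yN0 y : enorm y = r -> y != 0.
  by move=> yr; apply/eqP => y0; move: yr r_gt0; rewrite y0 enorm0 => ->; rewrite ltxx.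
have dP' y : enorm y = r -> enorm (y - x) < d -> dotp (y - x) nu = u (dotp (y - x) tau) /\
  derive1 u (dotp (y - x) tau) / Num.sqrt (1 + derive1 u (dotp (y - x) tau) ^+ 2)
      = - (dotp y tau / r).
  move=> yr yx; have := dP y y (yN0 y yr) (supports_eball yr) yx.
  by rewrite yr.
have d0x : enorm (x - x) < d by rewrite subrr enorm0.
have [ux psix] := dP' x xr d0x.
have dotp0 n : dotp (x - x) n = 0 by rewrite subrr /dotp /= !mul0r addr0.
rewrite !dotp0 in ux psix.
apply/eqP; rewrite -subr_eq0 -normr_eq0 eq_le normr_ge0 andbT.
apply/ler_addgt0Pr => e e0; rewrite add0r.
have [d2 d20 psiP] := is_derive_approx psi e0.
(* A second point of the circle near x, by the rational parametrisation. *)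
pose t := Num.min d d2 / (4 * r).
have m0 : 0 < Num.min d d2 by rewrite lt_min d0.
have t0 : 0 < t by rewrite divr_gt0// mulr_gt0.
have t2 : 0 < 1 + t ^+ 2 by rewrite ltr_pwDl ?sqr_ge0.
pose y : R * R := x + (2 * t / (1 + t ^+ 2)) *: ((- x.2, x.1) - t *: x).
have yxE : y - x = (2 * t / (1 + t ^+ 2)) *: ((- x.2, x.1) - t *: x).
  by rewrite /y addrC addKr.
have x2 : dotp x x = r ^+ 2 by rewrite -sqr_enorm xr.
have Jx2 : dotp ((- x.2, x.1) - t *: x) ((- x.2, x.1) - t *: x) = (1 + t ^+ 2) * r ^+ 2.
  by rewrite -x2 /dotp /= /GRing.scale /=; ring.
have yx2 : enorm (y - x) ^+ 2 = (2 * t * r) ^+ 2 / (1 + t ^+ 2).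
  by rewrite sqr_enorm yxE dotpZl dotpC dotpZl Jx2; field; rewrite gt_eqF.
have yr : enorm y = r.
  apply/eqP; rewrite -(@eqrXn2 _ 2)// ?enorm_ge0// ?(ltW r_gt0)// sqr_enorm -x2.
  apply/eqP; rewrite /y /dotp /= /GRing.scale /=; field.
  by rewrite gt_eqF.
have tr0 : 0 <= 2 * t * r.
  exact: mulr_ge0 (mulr_ge0 (ler0n _ 2) (ltW t0)) (ltW r_gt0).
have yx_le : enorm (y - x) < Num.min d d2.
  rewrite (@le_lt_trans _ _ (2 * t * r))//.
    rewrite -(ler_pXn2r (ltn0Sn 1)) ?nnegrE ?enorm_ge0 ?tr0//.
    by rewrite yx2 ler_pdivrMr// ler_peMr ?sqr_ge0// lerDl sqr_ge0.
  have -> : 2 * t * r = Num.min d d2 / 2 by rewrite /t; field; rewrite gt_eqF.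
  by move: m0; lra.
move: (yx_le); rewrite lt_min => /andP[yd yd2].
have [uy psiy] := dP' y yr yd.
set s := dotp (y - x) tau in uy psiy.
have s0 : s != 0.
  apply/eqP => s0; have := orthonormal_expand (y - x) tt nn tn.
  rewrite -/s uy s0 -ux !scale0r addr0 => yx0.
  move: yx2; rewrite yx0 enorm0 expr0n /= => /eqP; rewrite eq_sym.
  by rewrite gt_eqF// divr_gt0// exprn_gt0// (mulr_gt0 (mulr_gt0 _ t0)).
have s_le : `|s| < d2.
  by apply: le_lt_trans yd2; apply: normr_dotp_le; rewrite /enorm tt sqrtr1.
have := psiP s; rewrite !subr0 => /(_ s_le); rewrite psiy psix.
have -> : - (dotp y tau / r) - - (dotp x tau / r) - - h * s = (h - r^-1) * s.
  have -> : s = dotp y tau - dotp x tau by rewrite /s dotpBl.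
  by field; rewrite gt_eqF.
by rewrite normrM ler_pM2r// normr_gt0.
Qed.

End ball.

(** * One-dimensional Hausdorff measure *)

Section hausdorff.
Context {R : realType}.
Implicit Types (x y z : R * R) (A B : set (R * R)) (delta : R).
Local Open Scope ereal_scope.

Lemma ediam_ge0 A : 0 <= ediam A.
Proof. by apply: ereal_sup_ubound; left. Qed.

Lemma le_ediam A x y : A x -> A y -> (enorm (x - y))%:E <= ediam A.
Proof. by move=> Ax Ay; apply: ereal_sup_ubound; right; exists (x, y). Qed.

Lemma ediam_le A (c : \bar R) : 0 <= c ->
  (forall x y, A x -> A y -> (enorm (x - y))%:E <= c) -> ediam A <= c.
Proof.
move=> c0 H; apply: ge_ereal_sup => _ [->//|[[x y] [/= Ax Ay] <-]].
exact: H.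
Qed.

Lemma ediam0 : ediam (set0 : set (R * R)) = 0.
Proof. by apply/eqP; rewrite eq_le ediam_ge0 ediam_le. Qed.

Lemma hausdorff1_pre_ge0 delta A : 0 <= hausdorff1_pre delta A.
Proof.
apply: le_ereal_inf_tmp => _ [F _ <-]; apply: nneseries_ge0 => k _ _.
exact: ediam_ge0.
Qed.

Lemma hausdorff1_ge0 A : 0 <= hausdorff1 A.
Proof.
apply: le_trans (hausdorff1_pre_ge0 1%R A) _.
by apply: ereal_sup_ubound; exists 1%R => //=.
Qed.

Lemma hausdorff1_pre_le delta A (F : (set (R * R))^nat) :
  (forall k, ediam (F k) <= delta%:E) -> A `<=` \bigcup_k F k ->
  hausdorff1_pre delta A <= \sum_(0 <= k <oo) ediam (F k).
Proof. by move=> Fd AF; apply: ereal_inf_lbound; exists F. Qed.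

Lemma le_hausdorff1_pre delta A B : A `<=` B ->
  hausdorff1_pre delta A <= hausdorff1_pre delta B.
Proof.
move=> AB; apply: le_ereal_inf_tmp => _ [F [Fd BF] <-].
by apply: hausdorff1_pre_le => //; apply: subset_trans BF.
Qed.

(* On the discrete sigma-algebra every cover is measurable, so that the theory of
   mu_ext applies to the premeasure below. *)
Let diamd delta (A : set (g_sigma_algebraType [set: set (R * R)])) : \bar R :=
  if ediam A <= delta%:E then ediam A else +oo.

Let hausdorff1_preE delta A : hausdorff1_pre delta A = mu_ext (diamd delta) A.
Proof.
apply/eqP; rewrite eq_le; apply/andP; split.
  apply: le_ereal_inf_tmp => _ [F [_ AF] <-].
  have [Fd|] := pselect (forall k, ediam (F k) <= delta%:E).
    rewrite (eq_eseriesr (g := fun k => ediam (F k))); last first.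
      by move=> k _; rewrite /diamd Fd.
    exact: hausdorff1_pre_le.
  move/existsNP => [k /negP Fk]; rewrite (@eseries_pinfty _ _ _ k) ?leey//.
    by move=> n _; rewrite /diamd; case: ifP => // _; rewrite gt_eqF// (lt_le_trans _ (ediam_ge0 _)).
  by rewrite /diamd (negbTE Fk).
apply: le_ereal_inf_tmp => _ [F [Fd AF] <-].
apply: ereal_inf_lbound; exists F.
  by split => // i; exact: sub_sigma_algebra.
by apply: eq_eseriesr => k _; rewrite /diamd Fd.
Qed.

Lemma hausdorff1_pre_sigma_subadditive delta (F : (set (R * R))^nat) :
  hausdorff1_pre delta (\bigcup_k F k) <=
  \sum_(0 <= k <oo) hausdorff1_pre delta (F k).
Proof.
rewrite hausdorff1_preE; under eq_eseriesr do rewrite hausdorff1_preE.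
apply: mu_ext_sigma_subadditive => A; rewrite /diamd.
by case: ifP => // _; exact: ediam_ge0.
Qed.

Lemma hausdorff1_pre_bounded delta A : ediam A <= delta%:E ->
  hausdorff1_pre delta A <= ediam A.
Proof.
move=> Ad; pose F k := if k is 0%N then A else set0.
apply: (@le_trans _ _ (\sum_(0 <= k <oo) ediam (F k))).
  apply: hausdorff1_pre_le => [[|k]//=|x Ax]; last by exists 0%N.
  by rewrite ediam0 (le_trans _ Ad)// ediam_ge0.
rewrite nneseries_recl//; last by move=> *; exact: ediam_ge0.
rewrite eseries0 ?adde0// => -[|k] //= _ _.
by rewrite ediam0.
Qed.

Lemma hausdorff1_pre_subsingleton delta A : (0 < delta)%R ->
  (forall x y, A x -> A y -> x = y) -> hausdorff1_pre delta A = 0.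
Proof.
move=> d0 A1; have A0 : ediam A = 0.
  apply/eqP; rewrite eq_le ediam_ge0 andbT ediam_le// => x y Ax Ay.
  by rewrite (A1 x y)// subrr enorm0.
apply/eqP; rewrite eq_le hausdorff1_pre_ge0 andbT -A0 hausdorff1_pre_bounded//.
by rewrite A0 lee_fin ltW.
Qed.

Lemma hausdorff1_preU delta A B :
  hausdorff1_pre delta (A `|` B) <= hausdorff1_pre delta A + hausdorff1_pre delta B.
Proof.
have h0 : forall C, 0 <= hausdorff1_pre delta C by exact: hausdorff1_pre_ge0.
(* For negative delta no cover is admissible, as diameters are at least 0, and every value is +oo.
   Otherwise the empty sets completing the pair to a sequence cost nothing. *)
have [lt0|d0] := ltP delta 0%R.
  have noF C : hausdorff1_pre delta C = +oo.
    apply/eqP; rewrite eq_le leey /=; apply: le_ereal_inf_tmp => t [F [Fd _] _].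
    have := le_trans (ediam_ge0 (F 0%N)) (Fd 0%N).
    by rewrite lee_fin leNgt lt0.
  by rewrite !noF leey.
rewrite -bigcup2E (le_trans (hausdorff1_pre_sigma_subadditive _ _))//.
rewrite (@nneseriesD1 _ _ 0%N)//= (@nneseriesD1 _ _ 1%N)//=.
rewrite eseries0 ?adde0// => -[|[|k]] //= _ _.
apply/eqP; rewrite eq_le h0 andbT -[leRHS]ediam0.
by rewrite hausdorff1_pre_bounded// ediam0.
Qed.

(** Each cover of [D] by half-open intervals, as in the infimum defining [lebesgue_measure], is
    carried by [X] to a cover whose diameters are at most 1 / a times the lengths. The bound a delta
    on the diameter of [D] makes all these images admissible for [delta]. *)
Lemma hausdorff1_pre_lipschitz_image delta (a : R) (D : set R) (X : R -> R * R) :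
  (0 < a)%R -> (0 < delta)%R ->
  (forall s t, D s -> D t -> a * enorm (X s - X t) <= `|s - t|)%R ->
  (forall s t, D s -> D t -> `|s - t| <= a * delta)%R ->
  a%:E * hausdorff1_pre delta (X @` D) <= lebesgue_measure D.
Proof.
move=> a0 d0 Xlip Ddiam; apply: le_ereal_inf_tmp => _ [F [mF DF] <-].
have wl n : 0 <= wlength idfun (F n) by exact: wlength_ge0.
have FE n s t : F n s -> F n t -> (`|s - t|%:E <= wlength idfun (F n)).
  have /ocitvP[->//|[[b c] /= bc ->]] := mF n.
  rewrite /= !in_itv /= => /andP[s1 s2] /andP[t1 t2].
  rewrite wlength_itv /= lte_fin bc -EFinD lee_fin ler_norml.
  by apply/andP; split; lra.
pose G n := X @` (D `&` F n).
have Gw n : ediam (G n) <= a^-1%:E * wlength idfun (F n).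
  apply: ediam_le => [|_ _ [s [Ds Fs] <-] [t [Dt Ft] <-]].
    by rewrite mule_ge0// lee_fin invr_ge0 ltW.
  rewrite -lee_pdivrMl//; last by rewrite invr_gt0.
  rewrite invrK -EFinM (le_trans _ (FE n s t Fs Ft))// lee_fin.
  exact: Xlip.
have Gd n : ediam (G n) <= delta%:E.
  apply: ediam_le => [|_ _ [s [Ds Fs] <-] [t [Dt Ft] <-]].
    by rewrite lee_fin ltW.
  rewrite lee_fin -(ler_pM2l a0) (le_trans (Xlip _ _ Ds Dt))//.
  exact: Ddiam.
rewrite -lee_pdivlMl// -nneseriesZl; last by move=> i _; exact: wl.
apply: (@le_trans _ _ (\sum_(0 <= n <oo) ediam (G n))); last first.
  by apply: lee_nneseries => n *; [exact: ediam_ge0|exact: Gw].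
apply: hausdorff1_pre_le => // _ [t Dt <-].
by have [n _ Ft] := DF _ Dt; exists n => //; exists t.
Qed.

End hausdorff.

(** * Measurable inversion of the Gauss map *)

Section lipschitz_extension.
Context {R : realType}.

(* McShane's extension G t = inf_{s in M} (g s + L |t - s|). *)
Lemma lipschitz_extension (M : set R) (g : R -> R) (L : R) : 0 <= L ->
  (forall s t, M s -> M t -> `|g s - g t| <= L * `|s - t|) ->
  exists2 G : R -> R, continuous G & forall s, M s -> G s = g s.
Proof.
move=> L0 gL.
have [[s0 Ms0]|M0] := pselect (M !=set0); last first.
  exists (fun=> 0) => [|s Ms]; first exact: cst_continuous.
  by exfalso; apply: M0; exists s.
pose V t := [set g s + L * `|t - s| | s in M].
have V0 t : V t !=set0 by exists (g s0 + L * `|t - s0|), s0.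
have Vb t : lbound (V t) (g s0 - L * `|t - s0|).
  move=> _ [s Ms <-]; have := gL _ _ Ms0 Ms => /ler_normlP[_].
  have : L * `|s0 - s| <= L * `|t - s0| + L * `|t - s|.
    rewrite -mulrDr ler_wpM2l// (distrC t s0).
    by have := ler_normD (s0 - t) (t - s); rewrite addrA subrK.
  lra.
have Vlb t : has_lbound (V t) by exists (g s0 - L * `|t - s0|).
pose G t := inf (V t).
have GL s t : G s <= G t + L * `|s - t|.
  rewrite -lerBlDr; apply: lb_le_inf => // _ [r Mr <-].
  rewrite lerBlDr (@le_trans _ _ (g r + L * `|s - r|))//.
    by apply: ge_inf => //; exists r.
  rewrite -addrA lerD2l -mulrDr ler_wpM2l//.
  by have := ler_normD (s - t) (t - r); rewrite addrA subrK [leRHS]addrC.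
exists G.
  move=> t; apply/cvgrPdist_lt => e e0.
  have L1 : 0 < L + 1 by rewrite ltr_wpDl.
  apply/nbhs_ballP; exists (e / (L + 1)); first by rewrite /= divr_gt0.
  move=> s; rewrite /ball /= ltr_pdivlMr// => st.
  have := GL s t; have := GL t s; rewrite (distrC s t).
  have : L * `|t - s| < e.
    by move: st; rewrite mulrDr mulr1 mulrC; have := normr_ge0 (t - s); lra.
  by move=> ? ? ?; rewrite ltr_norml; apply/andP; split; lra.
move=> s Ms; apply/eqP; rewrite eq_le; apply/andP; split.
  by apply: ge_inf => //; exists s => //; rewrite subrr normr0 mulr0 addr0.
apply: lb_le_inf => // _ [r Mr <-].
by have := gL _ _ Ms Mr => /ler_normlP[_]; lra.
Qed.

End lipschitz_extension.

Section inverse_gauss_map.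
Context {R : realType}.
(** Here [N x m] stands for m being the slope of a normal at x, [A] for a piece of boundary where
    the integrand is at least c, and [Phi] for a bound of the weight per unit slope. By
    [N_expanding] the slope moves away from m at any speed a below c / Phi m, so that length on [A]
    has, formally, density at most Phi / c in the slope. *)
Variables (delta c : R) (N : R * R -> R -> Prop) (A : set (R * R)) (Phi : R -> R).
Hypotheses (delta_gt0 : 0 < delta) (c_gt0 : 0 < c).
Hypothesis N_closed : forall X1 X2 : R -> R, continuous X1 -> continuous X2 ->
  closed [set m | N (X1 m, X2 m) m].
Hypothesis A_meas : measurable A.
Hypothesis Phi_meas : measurable_fun [set: R] Phi.
Hypothesis Phi_gt0 : forall x m, A x -> N x m -> 0 < Phi m.
Hypothesis N_expanding : forall x m a, A x -> N x m -> 0 < a -> a * Phi m < c ->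
  exists2 d, 0 < d & forall y m', N y m' -> enorm (y - x) < d ->
    a * enorm (y - x) <= `|m' - m|.
Hypothesis N_inj : forall x y m, A x -> A y -> N x m -> N y m -> x = y.

Definition slopes_over := [set m | exists2 x, A x & N x m].

(* x is found at slope m, and near x the slope moves at speed at least a;
   the rational data localise x and m, so that x is a Lipschitz function of m. *)
Let P (t : rat * nat * (rat * rat) * rat) (x : R * R) (m : R) :=
  let: (a, n, p, s) := t in
  [/\ N x m,
      forall y m', N y m' -> enorm (y - x) < n.+1%:R^-1 ->
        ratr a * enorm (y - x) <= `|m' - m|,
      enorm (x - (ratr p.1, ratr p.2)) <= n.+1%:R^-1 / 3 &
      `|m - ratr s| <= ratr a * delta / 2].

Let rate (t : rat * nat * (rat * rat) * rat) : R := ratr t.1.1.1.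

(** The factor 1 / 3 in [P] puts two points with the same data within 2 / 3 of the radius 1 / (n +
    1), so that the expansion clause applies to them. *)
Let P_lipschitz t x y m m' : P t x m -> P t y m' ->
  rate t * enorm (y - x) <= `|m' - m|.
Proof.
case: t => [[[a n] p] s] [Nx Hx xp ms] [Ny Hy yp ms'].
apply: Hx => //; have n0 : 0 < n.+1%:R^-1 :> R by rewrite invr_gt0.
rewrite (le_lt_trans (enorm_dist _ (ratr p.1, ratr p.2) _))//.
rewrite [X in _ + X]enormB; move: xp yp n0; move: (n.+1%:R^-1) => u. lra.
Qed.

Let P_close t x y m m' : P t x m -> P t y m' -> `|m - m'| <= rate t * delta.
Proof.
case: t => [[[a n] p] s] [_ _ _ ms] [_ _ _ ms'].
have := ler_normD (m - ratr s) (ratr s - m'); rewrite addrA subrK.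
rewrite [X in _ <= _ + X]distrC /rate /=; move: ms ms'; move: (ratr a * _) => u; lra.
Qed.

Let closed_le_continuous (f g : R -> R) : continuous f -> continuous g ->
  closed [set m | f m <= g m].
Proof.
move=> cf cg; have -> : [set m | f m <= g m] = (g - f) @^-1` [set x | 0 <= x].
  by apply/seteqP; split=> m /=; rewrite subr_ge0.
apply: preimage_closed; last exact: closed_ge.
by move=> m _; apply: cvgB; [exact: cg|exact: cf].
Qed.

Let continuous_enorm_pair (X1 X2 : R -> R) (z : R * R) :
  continuous X1 -> continuous X2 -> continuous (fun m => enorm (z - (X1 m, X2 m))).
Proof.
move=> c1 c2 m.
apply: (@continuous_comp _ _ _ (fun m => z - (X1 m, X2 m)) (@enorm R)); last first.
  exact: continuous_enorm.
apply: cvgB; first exact: cvg_cst.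
exact: (cvg_pair (c1 m) (c2 m)).
Qed.

(** Along continuous curves the condition is an intersection of closed ones: the implication from
    closeness to expansion becomes, for each (y, m') in [N], the union of two sets given by large
    inequalities. *)
Let P_closed t (X1 X2 : R -> R) : continuous X1 -> continuous X2 ->
  closed [set m | P t (X1 m, X2 m) m].
Proof.
case: t => [[[a n] p] s] c1 c2.
have -> : [set m | P (a, n, p, s) (X1 m, X2 m) m] =
  [set m | N (X1 m, X2 m) m] `&`
  (\bigcap_(z in [set z | N z.1 z.2])
     ([set m | n.+1%:R^-1 <= enorm (z.1 - (X1 m, X2 m))] `|`
      [set m | ratr a * enorm (z.1 - (X1 m, X2 m)) <= `|z.2 - m|])) `&`
  [set m | enorm ((ratr p.1, ratr p.2) - (X1 m, X2 m)) <= n.+1%:R^-1 / 3] `&`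
  [set m | `|m - ratr s| <= ratr a * delta / 2].
  apply/seteqP; split => m /=.
    move=> [h1 h2 h3 h4]; split; last exact: h4.
    split; last by rewrite /= enormB.
    split; first exact: h1.
    move=> [y m'] /= Ny; have [lt|le] := ltP (enorm (y - (X1 m, X2 m))) n.+1%:R^-1.
      by right; exact: h2.
    by left.
  move=> [[[h1 h2] h3] h4]; split => //; last by rewrite enormB.
  move=> y m' Ny lt; have [/=|//] := h2 (y, m') Ny.
  by rewrite leNgt lt.
have cnorm (z : R) : continuous (fun m => `|z - m|).
  move=> m; apply: cvg_norm; apply: cvgB; [exact: cvg_cst|exact: cvg_id].
apply: closedI; last first.
  apply: closed_le_continuous; last exact: cst_continuous.
  by under eq_fun do rewrite distrC; exact: cnorm.
apply: closedI; last first.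
  by apply: closed_le_continuous; [exact: continuous_enorm_pair|exact: cst_continuous].
apply: closedI; first exact: N_closed.
apply: closed_bigI => z _; apply: closedU.
  by apply: closed_le_continuous; [exact: cst_continuous|exact: continuous_enorm_pair].
apply: closed_le_continuous; last exact: cnorm.
by move=> m; apply: cvgM; [exact: cvg_cst|exact: continuous_enorm_pair].
Qed.

(** The last clause says that the rational speed is within the factor q of its supremum c / Phi
    m. *)
Let piece (q : R) t := if 0 < rate t then
  [set m | exists x, [/\ P t x m, A x & q * c <= rate t * Phi m]] else set0.

(** On the slopes where [P t] holds for some point, that point is a Lipschitz function of the slope.
    Extending both coordinates to continuous functions on the line turns the existential into a
    closed condition and two preimages of measurable sets, although the original domain [M0] is not
    known to be measurable. *)
Let piece_measurable q t : measurable (piece q t).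
Proof.
rewrite /piece; case: ifPn => // a0.
pose M0 := [set m | exists x, P t x m].
pose X m := xget 0 [set x | P t x m].
have XP m : M0 m -> P t (X m) m by move=> /xgetPex; apply.
have Xlip : forall s r, M0 s -> M0 r ->
    enorm (X s - X r) <= (rate t)^-1 * `|s - r|.
  move=> s r /XP Ps /XP Pr; rewrite ler_pdivlMl//.
  exact: P_lipschitz Pr Ps.
have a0' : 0 <= (rate t)^-1 by rewrite invr_ge0 ltW.
have [X1 cX1 X1E] : exists2 G : R -> R, continuous G & forall s, M0 s -> G s = (X s).1.
  apply: (lipschitz_extension a0') => s r Ms Mr.
  by rewrite (le_trans _ (Xlip _ _ Ms Mr))//; exact: (fst_le_enorm (X s - X r)).
have [X2 cX2 X2E] : exists2 G : R -> R, continuous G & forall s, M0 s -> G s = (X s).2.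
  apply: (lipschitz_extension a0') => s r Ms Mr.
  by rewrite (le_trans _ (Xlip _ _ Ms Mr))//; exact: (snd_le_enorm (X s - X r)).
have P_fun x y m : P t x m -> P t y m -> x = y.
  move=> Px Py; have := P_lipschitz Px Py; rewrite subrr normr0 pmulr_rle0// => le0.
  apply/esym/subr0_eq/enorm0_eq0; apply/eqP; rewrite eq_le le0.
  exact: enorm_ge0.
have -> : [set m | exists x, [/\ P t x m, A x & q * c <= rate t * Phi m]] =
  [set m | P t (X1 m, X2 m) m] `&`
  ((fun m => (X1 m, X2 m)) @^-1` A `&` [set m | q * c <= rate t * Phi m]).
  apply/seteqP; split=> m /=.
    move=> [x [Px Ax qc]]; have M0m : M0 m by exists x.
    have -> : (X1 m, X2 m) = x.
      by rewrite X1E// X2E// -surjective_pairing; apply: P_fun Px; exact: XP.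
    by [].
  by move=> [Px [Ax qc]]; exists (X1 m, X2 m).
apply: measurableI; first by apply: closed_measurable; exact: P_closed.
apply: measurableI.
  rewrite -[X in measurable X]setTI.
  by apply: measurable_fun_pair => //; exact: continuous_measurable_fun.
rewrite -[X in measurable X]setTI.
apply: measurable_fun_le => //.
exact: measurable_funM.
Qed.

Let pieces q k := if unpickle k is Some t then piece q t else set0.

Let slopes_overE q : 0 < q -> q < 1 -> slopes_over = \bigcup_k pieces q k.
Proof.
move=> q0 q1; apply/seteqP; split => m; last first.
  move=> [k _]; rewrite /pieces; case: unpickle => // t.
  rewrite /piece; case: ifP => // _ [x [Px Ax _]]; exists x => //.
  by case: t Px => [[[a n] p] s] [].
move=> [x Ax Nx]; have Phi0 := Phi_gt0 Ax Nx.
(* A rational speed in this gap is slow enough for [N_expanding] and fast enough for [piece q]. *)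
have : q * c / Phi m < c / Phi m.
  by rewrite ltr_pM2r ?invr_gt0// gtr_pMl.
move=> /rat_in_itvoo[a]; rewrite in_itv /= => /andP[a1 a2].
have a0 : 0 < ratr a :> R.
  by apply: lt_trans a1; rewrite divr_gt0// mulr_gt0.
have aP : ratr a * Phi m < c by rewrite -ltr_pdivlMr.
have [d d0 dP] := N_expanding Ax Nx a0 aP.
pose n := Num.truncn d^-1.
have di0 : 0 < d^-1 by rewrite invr_gt0.
have nd : n.+1%:R^-1 < d.
  by rewrite invf_plt ?posrE//; have /andP[] := truncn_itv (ltW di0).
have rat_near (y e : R) : 0 < e -> exists p, `|y - ratr p| < e.
  move=> e0; have /rat_in_itvoo[p] : y - e < y + e by lra.
  rewrite in_itv /= => /andP[p1 p2]; exists p.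
  by rewrite ltr_norml; apply/andP; split; lra.
(* Two coordinate errors of 1 / 6 of the radius add up to the 1 / 3 required by [P]. *)
have u0 : 0 < n.+1%:R^-1 / 6 :> R by rewrite divr_gt0// invr_gt0.
have [p1 xp1] := rat_near x.1 _ u0.
have [p2 xp2] := rat_near x.2 _ u0.
have ad0 : 0 < ratr a * delta / 2 by rewrite !divr_gt0// mulr_gt0.
have [s ms] := rat_near m _ ad0.
have [k kE] : exists k, unpickle k = Some (a, n, (p1, p2), s).
  by exists (pickle (a, n, (p1, p2), s)); exact: pickleK.
exists k => //; rewrite /pieces kE /piece {1}/rate /= a0.
exists x; split => //; last by rewrite -ler_pdivrMr// ltW.
split => //; last exact: ltW.
  move=> y m' Ny yx; apply: dP => //; exact: lt_trans nd.
rewrite (le_trans (enorm_le_add _))//=.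
by move: xp1 xp2; move: (n.+1%:R^-1) => u; lra.
Qed.

Lemma measurable_slopes_over : measurable slopes_over.
Proof.
rewrite (@slopes_overE (1 / 2)); [|lra|lra].
apply: bigcupT_measurable => k; rewrite /pieces; by case: unpickle.
Qed.

(** On a disjointed piece with speed a, the points form a Lipschitz image of the slopes, so a times
    their premeasure is at most the Lebesgue measure of the slopes, while q c / a <= Phi there.
    Summing needs subadditivity on the side of points and additivity only on the side of slopes;
    then q tends to 1. *)
Lemma hausdorff1_pre_le_integral_slopes :
  (c%:E * hausdorff1_pre delta (A `&` [set x | exists m, N x m]) <=
   \int[lebesgue_measure]_(m in slopes_over) (Phi m)%:E)%E.
Proof.
apply/lee_mul01Pr.
  by rewrite mule_ge0 ?hausdorff1_pre_ge0// lee_fin ltW.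
move=> q /andP[q0 q1]; rewrite muleA -EFinM.
have qc0 : 0 < q * c by rewrite mulr_gt0.
have mpieces k : measurable (pieces q k).
  rewrite /pieces; by case: unpickle.
pose D := seqDU (pieces q).
have mD k : measurable (D k) by exact: seqDU_measurable.
have DE : slopes_over = \bigcup_k D k.
  by rewrite (slopes_overE q0 q1) seqDU_bigcup_eq.
have DPhi k m : D k m -> 0 < Phi m.
  move=> Dm; have [x Ax Nx] : slopes_over m by rewrite DE; exists k.
  exact: Phi_gt0 Nx.
have mPhi (S : set R) : measurable_fun S (EFin \o Phi).
  by apply/measurable_EFinP; exact: measurable_funS Phi_meas.
pose B k := [set x | A x /\ exists2 m, D k m & N x m].
have AB : A `&` [set x | exists m, N x m] `<=` \bigcup_k B k.
  move=> x [Ax [m Nx]]; have : slopes_over m by exists x.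
  by rewrite DE => -[k _ Dm]; exists k => //; split => //; exists m.
rewrite DE ge0_integral_bigcup//; last 3 first.
- exact: mPhi.
- by move=> m [k _ Dm]; rewrite lee_fin ltW// (DPhi _ _ Dm).
- exact: trivIset_seqDU.
have h0 C := hausdorff1_pre_ge0 delta C.
apply: (@le_trans _ _ ((q * c)%:E * \sum_(0 <= k <oo) hausdorff1_pre delta (B k))%E).
  rewrite lee_pmul2l// ?lte_fin//.
  by rewrite (le_trans (le_hausdorff1_pre _ AB))// hausdorff1_pre_sigma_subadditive.
rewrite -nneseriesZl; last by move=> k _; exact: h0.
apply: lee_nneseries => k _; first by rewrite mule_ge0// lee_fin ltW.
have int0 : (0 <= \int[lebesgue_measure]_(m in D k) (Phi m)%:E)%E.
  by apply: integral_ge0 => m /DPhi Phi0; rewrite lee_fin ltW.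
have Dsub : D k `<=` pieces q k by exact: subset_seqDU.
have DkB : pieces q k = set0 -> ((q * c)%:E * hausdorff1_pre delta (B k) <=
    \int[lebesgue_measure]_(m in D k) (Phi m)%:E)%E.
  move=> k0; rewrite hausdorff1_pre_subsingleton ?mule0// => x y [_ [m Dm _]].
  by move: (Dsub m Dm); rewrite k0.
have [[t pE] | ] := pselect (exists t, pieces q k = piece q t /\ 0 < rate t); last first.
  move=> nt; apply: DkB; rewrite /pieces; case E : unpickle => [t|//].
  rewrite /piece; case: ifPn => // a0; exfalso; apply: nt; exists t.
  by rewrite /pieces E.
have {pE}[pE a0] := pE.
have DP m : D k m -> exists x, [/\ P t x m, A x & q * c <= rate t * Phi m].
  by move=> /Dsub; rewrite pE /piece a0.
pose X m := xget 0 [set x | P t x m].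
have XP m : D k m -> P t (X m) m.
  move=> /DP[x [Px _ _]]; rewrite /X; apply: (@xgetPex _ 0 [set x | P t x m]); by exists x.
(* The piece provides some point of [A] with slope m that satisfies [P t]; [N_inj] identifies it
   with the given x. *)
have BX : B k `<=` X @` D k.
  move=> x [Ax [m Dm Nx]]; exists m => //.
  have [x' [Px' Ax' _]] := DP m Dm.
  have Nx' : N x' m by case: (t) Px' => [[[? ?] ?] ?] [].
  have -> : x = x' by exact: N_inj Nx Nx'.
  have := P_lipschitz Px' (XP m Dm); rewrite subrr normr0 pmulr_rle0// => le0.
  by apply/subr0_eq/enorm0_eq0; apply/eqP; rewrite eq_le le0 enorm_ge0.
have := @hausdorff1_pre_lipschitz_image _ delta (rate t) (D k) X a0 delta_gt0.
move=> /(_ _ _)/wrap[].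
  by move=> s s' Ds Ds'; exact: P_lipschitz (XP _ Ds') (XP _ Ds).
  by move=> s s' Ds Ds'; exact: P_close (XP _ Ds) (XP _ Ds').
move=> le1.
have qcr0 : 0 < q * c / rate t := divr_gt0 qc0 a0.
apply: (@le_trans _ _ ((q * c / rate t)%:E * lebesgue_measure (D k))%E).
  have {1}-> : q * c = q * c / rate t * rate t by rewrite divfK ?gt_eqF.
  rewrite EFinM -muleA.
  rewrite lee_pmul2l ?lte_fin//; apply: le_trans le1.
  by rewrite lee_pmul2l ?lte_fin//; exact: le_hausdorff1_pre.
have <- : (\int[lebesgue_measure]_(m in D k) (q * c / rate t)%:E =
    (q * c / rate t)%:E * lebesgue_measure (D k))%E.
  by rewrite integral_cst; [reflexivity|exact: mD].
apply: ge0_le_integral.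
- exact: mD.
- by move=> m _; rewrite lee_fin ltW.
- exact: measurable_cst.
- exact: mPhi.
- by move=> m /DP[x [_ _ le]]; rewrite lee_fin ler_pdivrMr// [leRHS]mulrC.
Qed.

End inverse_gauss_map.

(** * Length of the circle *)

Section circle.
Context {R : realType}.

Lemma near_sin_lower (k : R) : k < 1 ->
  exists2 t0, 0 < t0 & forall t, 0 <= t -> t < t0 -> k * t <= sin t.
Proof.
move=> k1; have e0 : 0 < 1 - k by rewrite subr_gt0.
have [d d0 dP] := is_derive_approx (is_derive_sin (0 : R)) e0.
exists d => // t t0 td; have := dP t; rewrite subr0 ger0_norm// => /(_ td).
by rewrite sin0 cos0 subr0 mul1r => /ler_normlP[]; lra.
Qed.

Lemma enorm_arc (r s t : R) : 0 <= r ->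
  enorm ((r * cos s, r * sin s) - (r * cos t, r * sin t))
  = 2 * r * `|sin ((s - t) / 2)|.
Proof.
move=> r0; have r20 : 0 <= 2 * r by rewrite mulr_ge0.
apply/eqP; rewrite -(@eqrXn2 _ 2)// ?enorm_ge0 ?mulr_ge0//.
rewrite sqr_enorm exprMn real_normK ?num_real//; apply/eqP.
have : cos (((s - t) / 2) *+ 2) = cos (s - t) by rewrite -mulr_natr divfK.
rewrite cos_mulr2n cosB => c2.
have := cos2Dsin2 ((s - t) / 2); have := cos2Dsin2 s; have := cos2Dsin2 t.
move=> ct cs ch.
have -> : sin ((s - t) / 2) ^+ 2 = (1 - (cos s * cos t + sin s * sin t)) / 2.
  by move: c2 ch; lra.
transitivity (r ^+ 2 * ((cos s ^+ 2 + sin s ^+ 2) + (cos t ^+ 2 + sin t ^+ 2)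
   - 2 * (cos s * cos t + sin s * sin t))).
  by rewrite /dotp /=; ring.
by rewrite cs ct; field.
Qed.

(** This rules out short chords between angles that are not close. *)
Lemma sin_lower_far (a b : R) : 0 < a -> b < pi ->
  exists2 m : R, 0 < m & forall t, a <= t -> t <= b -> m <= sin t.
Proof.
move=> a0 bpi; have [ab|ba] := leP a b; last first.
  by exists 1 => // t at_ tb; move: (le_trans at_ tb); rewrite leNgt ba.
have csin : {within `[a, b], continuous (@sin R)}.
  by apply: continuous_subspaceT; exact: continuous_sin.
have [c cab cmin] := EVT_min ab csin.
exists (sin c).
  move: cab; rewrite in_itv /= => /andP[ac cb].
  by apply: sin_gt0_pi; rewrite (lt_le_trans a0 ac) (le_lt_trans cb bpi).
by move=> t at_ tb; apply: cmin; rewrite in_itv /= at_.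
Qed.

(** The sets [J k] need not be measurable; each one lies in the closed interval of length [D k] that
    starts at its infimum. *)
Lemma lebesgue_measure_le_diameters (I : set R) (J : (set R)^nat)
    (D : nat -> \bar R) : measurable I -> I `<=` \bigcup_k J k ->
  (forall k, 0 <= D k)%E ->
  (forall k s t, J k s -> J k t -> (`|s - t|%:E <= D k)%E) ->
  (lebesgue_measure I <= \sum_(0 <= k <oo) D k)%E.
Proof.
move=> mI IJ D0 JD.
have [[k Dk]|noo] := pselect (exists k, D k = +oo%E).
  by rewrite (eseries_pinfty _ _ Dk) ?leey// => n _; rewrite gt_eqF// (lt_le_trans _ (D0 _)).
pose d k := fine (D k).
have DE k : D k = (d k)%:E.
  rewrite /d fineK// ge0_fin_numE// ltey.
  by apply/eqP => Dk; apply: noo; exists k.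
have d0 k : 0 <= d k by rewrite -lee_fin -DE.
pose K k : set R := if pselect (J k !=set0) then `[inf (J k), inf (J k) + d k]%classic else set0.
have mK k : measurable (K k) by rewrite /K; case: pselect => ?; [exact: measurable_itv|exact: measurable0].
have KE k : (lebesgue_measure (K k) <= D k)%E.
  rewrite /K; case: pselect => ?; last by rewrite measure0.
  rewrite lebesgue_measure_itv /= lte_fin ltrDl; case: ifP => _ //.
  by rewrite -EFinD addrAC subrr add0r DE.
have JK k : J k `<=` K k.
  move=> t Jt; rewrite /K; case: pselect => [J0 | []]; last by exists t.
  have lb s : J k s -> lbound (J k) (s - d k).
    move=> Js u Ju; have := JD k s u Js Ju; rewrite DE lee_fin => /ler_normlP[]; lra.
  rewrite /= in_itv /=; apply/andP; split.
    by apply: ge_inf => //; exists (t - d k); exact: lb.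
  by rewrite -lerBlDr; apply: lb_le_inf => //; exact: lb.
apply: (@le_trans _ _ (\sum_(0 <= k <oo) lebesgue_measure (K k))%E).
  apply: measure_sigma_subadditive => // x Ix.
  by have [k _ Jx] := IJ x Ix; exists k => //; exact: JK.
by apply: lee_nneseries => k *; [exact: measure_ge0|exact: KE].
Qed.

(** A cover of the circle by small sets is pulled back to the angles, where it has to cover an
    interval. The factor q shortens this interval, so that points near the two ends of the
    parametrisation are not mistaken for distant ones; the factor k compares chord and arc. *)
Lemma hausdorff1_circle_ge (r : R) : 0 < r ->
  ((2 * pi * r)%:E <= hausdorff1 [set x | enorm x = r])%E.
Proof.
move=> r0; have pi0 := pi_gt0 R.
apply/lee_mul01Pr; first by rewrite lee_fin ltW// !mulr_gt0.
move=> q /andP[q0 q1]; rewrite -EFinM.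
have q2 : 0 < q * (2 * pi * r) by rewrite !mulr_gt0.
apply/lee_mul01Pr; first by rewrite lee_fin ltW.
move=> k /andP[k0 k1]; rewrite -EFinM.
have [t0 t00 t0P] := near_sin_lower k1.
have qpi : q * pi < pi by rewrite gtr_pMl.
have [m m0 mP] := sin_lower_far t00 qpi.
pose I : set R := `]- (q * pi), (q * pi)[%classic.
have lI : lebesgue_measure I = (2 * (q * pi))%:E.
  rewrite lebesgue_measure_itv /= lte_fin ifT -?EFinB.
    by congr EFin; ring.
  by have := mulr_gt0 q0 pi0; lra.
have rm0 : 0 < r * m by rewrite mulr_gt0.
have arc s t : I s -> I t ->
    enorm ((r * cos s, r * sin s) - (r * cos t, r * sin t)) <= r * m ->
    r * k * `|s - t| <= enorm ((r * cos s, r * sin s) - (r * cos t, r * sin t)).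
  rewrite /I /= !in_itv /= => /andP[s1 s2] /andP[t1 t2].
  rewrite enorm_arc ?(ltW r0)//.
  have -> : `|sin ((s - t) / 2)| = sin (`|s - t| / 2).
    have h0 : 0 <= `|s - t| / 2 by rewrite divr_ge0.
    have hpi : `|s - t| / 2 <= pi.
      by rewrite ler_pdivrMr// ler_norml; apply/andP; split; lra.
    have sin0 : 0 <= sin (`|s - t| / 2).
      by apply: sin_ge0_pi; rewrite h0.
    rewrite -(ger0_norm sin0); have [st|st] := leP 0 (s - t).
      by rewrite (ger0_norm st).
    by rewrite (ltr0_norm st) mulNr sinN normrN.
  set h := `|s - t| / 2.
  have h0 : 0 <= h by rewrite divr_ge0.
  have hq : h <= q * pi.
    by rewrite /h ler_pdivrMr// ler_norml; apply/andP; split; lra.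
  have -> : `|s - t| = 2 * h by rewrite /h; field.
  (* The chord is 2 r sin h. A half-angle h >= t0 would make it at least 2 r m, above the admissible
     r m. *)
  move=> le; have [ht|th] := ltP h t0.
    have := t0P h h0 ht; rewrite -(ler_pM2l r0); lra.
  have := mP h th hq; rewrite -(ler_pM2l r0) => le2.
  by exfalso; move: rm0; lra.
apply: (@le_trans _ _ (hausdorff1_pre (r * m) [set x | enorm x = r])); last first.
  by apply: ereal_sup_ubound; exists (r * m).
apply: le_ereal_inf_tmp => _ [F [Fd FC] <-].
have rk0 : 0 < r * k by rewrite mulr_gt0.
have -> : k * (q * (2 * pi * r)) = (r * k) * (2 * (q * pi)) by ring.
rewrite EFinM -lI -lee_pdivlMl// -nneseriesZl; last by move=> i _; exact: ediam_ge0.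
pose J n := [set s | I s /\ F n (r * cos s, r * sin s)].
apply: (@lebesgue_measure_le_diameters _ J).
- exact: measurable_itv.
- move=> s Is; have [|n _ Fn] := FC (r * cos s, r * sin s); last by exists n.
  rewrite /= /enorm /dotp /=.
  have -> : r * cos s * (r * cos s) + r * sin s * (r * sin s) = r ^+ 2.
    by rewrite -[RHS]mulr1 -(cos2Dsin2 s); ring.
  by rewrite sqrtr_sqr gtr0_norm.
- by move=> n; rewrite mule_ge0 ?ediam_ge0// lee_fin invr_ge0 ltW.
move=> n s t [Is Fs] [It Ft]; rewrite lee_pdivlMl//.
have le1 := le_ediam Fs Ft.
rewrite -EFinM (le_trans _ le1)// lee_fin; apply: arc => //.
by rewrite -lee_fin (le_trans le1).
Qed.

End circle.

(** * Integration over the plane in slope coordinates *)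

Section lebesgue_plane.
Context {R : realType}.
Local Notation mu := (@lebesgue_measure R).
Local Open Scope ereal_scope.

(** The sigma-algebra on the plane is the product one; an open set is the countable union of the
    rational boxes that it contains. *)
Lemma open_measurable_plane (E : set (R * R)) : open E -> measurable E.
Proof.
move=> oE.
pose box (t : rat * rat * rat * rat) : set (R * R) :=
  `]ratr t.1.1.1, ratr t.1.1.2[%classic `*` `]ratr t.1.2, ratr t.2[%classic.
pose F t := if pselect (box t `<=` E) then box t else set0.
have -> : E = \bigcup_t F t.
  apply/seteqP; split=> [x Ex|x [t _]]; last by rewrite /F; case: pselect => // sub; exact: sub.
  have [d d0 dE] := open_enormP oE Ex.
  have d2 : (0 < d / 2)%R by rewrite divr_gt0.
  have sep (y : R) : exists a b, [/\ y - d / 2 < ratr a, ratr a < y, y < ratr b &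
      ratr b < y + d / 2]%R.
    have /rat_in_itvoo[a] : (y - d / 2 < y)%R by rewrite ltrBlDr ltrDl.
    have /rat_in_itvoo[b] : (y < y + d / 2)%R by rewrite ltrDl.
    by rewrite !in_itv /= => /andP[? ?] /andP[? ?]; exists a, b; split.
  have [a [b [a1 a2 b1 b2]]] := sep x.1; have [a' [b' [a1' a2' b1' b2']]] := sep x.2.
  exists (a, b, a', b') => //; rewrite /F; case: pselect => [?|[]].
    by split; rewrite /= in_itv /= ?a2 ?b1 ?a2' ?b1'.
  move=> y [/=]; rewrite !in_itv /= => /andP[y1 y2] /andP[y1' y2'].
  apply: dE; rewrite (le_lt_trans (enorm_le_add _))//= (splitr d) ltrD//.
    by rewrite ltr_norml; apply/andP; split; lra.
  by rewrite ltr_norml; apply/andP; split; lra.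
apply: countable_bigcupT_measurable => // t; rewrite /F; case: pselect => ?; last exact: measurable0.
by apply: measurableX; exact: measurable_itv.
Qed.

Lemma lebesgue_measure_dilation (c : R) : (0 < c)%R -> forall A, measurable A ->
  c%:E * pushforward mu (fun x : measurableTypeR R => c * x : measurableTypeR R)%R A = mu A.
Proof.
move=> c0 A mA.
have mc : measurable_fun [set: measurableTypeR R]
  (fun x : measurableTypeR R => c * x : measurableTypeR R)%R.
  exact: mulrl_measurable.
pose k : {nonneg R} := NngNum (ltW c0).
pose nu := mscale k (measure_function_pushforward__canonical__measure_function_Measure mu mc).
have nuE B : nu B = c%:E * mu ((fun x : R => c * x)%R @^-1` B) by [].
apply/esym; rewrite -[RHS]nuE.
apply: lebesgue_measure_unique => //= _ [[a b]] _ <-.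
transitivity (c%:E * mu `](a / c)%R, (b / c)%R]%classic); last first.
  rewrite -[RHS]/(c%:E * mu ((fun x : R => c * x)%R @^-1` `]a, b]%classic)).
  congr (_ * mu _); apply/seteqP; split=> x /=;
  by rewrite !in_itv /= ltr_pdivrMr// ler_pdivlMr// mulrC.
rewrite !lebesgue_measure_itv /= !lte_fin ltr_pM2r ?invr_gt0//.
case: ifP => _; last by rewrite mule0.
by rewrite -!EFinB -EFinM -mulrBl mulrC divfK ?gt_eqF.
Qed.

Lemma ge0_integral_dilation (c : R) (F : R -> \bar R) : (0 < c)%R ->
  measurable_fun [set: R] F -> (forall t, 0 <= F t) ->
  \int[mu]_t (c%:E * F (c * t)%R) = \int[mu]_t F t.
Proof.
move=> c0 mF F0.
have mc : measurable_fun [set: measurableTypeR R]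
  (fun x : measurableTypeR R => c * x : measurableTypeR R)%R.
  exact: mulrl_measurable.
rewrite ge0_integralZl//; last 2 first.
- by apply: (measurableT_comp mF mc).
- by rewrite lee_fin ltW.
have := ge0_integral_pushforward mc mu measurableT mF (fun t _ => F0 t).
rewrite preimage_setT /= => <-.
pose k : {nonneg R} := NngNum (ltW c0).
pose nu := measure_function_pushforward__canonical__measure_function_Measure mu mc.
rewrite -[c%:E]/(k%:num%:E) -(ge0_integral_mscale nu)//.
apply: eq_measure_integral => A mA _.
exact: lebesgue_measure_dilation.
Qed.

Lemma ge0_integral_reflection (F : R -> \bar R) :
  measurable_fun [set: R] F -> (forall t, 0 <= F t) ->
  \int[mu]_t F (- t)%R = \int[mu]_t F t.
Proof.
move=> mF F0.
have mN : measurable_fun [set: measurableTypeR R] (-%R : _ -> measurableTypeR R).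
  exact: oppr_measurable.
have := ge0_integral_pushforward mN mu measurableT mF (fun t _ => F0 t).
rewrite preimage_setT /= => <-.
apply: (@eq_measure_integral _ _ _ _ mu (measure_function_pushforward__canonical__measure_function_Measure mu mN)).
by move=> A mA _; exact: lebesgue_measureN.
Qed.

Lemma ge0_integral_halves (F : R -> \bar R) :
  measurable_fun [set: R] F -> (forall t, 0 <= F t) ->
  \int[mu]_t F t =
  \int[mu]_(t in `]0%R, +oo[) F t + \int[mu]_(t in `]0%R, +oo[) F (- t)%R.
Proof.
move=> mF F0.
have mFN : measurable_fun [set: R] (fun t : R => F (- t)%R).
  exact: (measurableT_comp mF (@oppr_measurable R setT)).
have h : \int[mu]_(t in `[0%R, +oo[) F (- t)%R = \int[mu]_(t in `]-oo, 0%R]) F t.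
  rewrite (ge0_integration_by_substitution0 mFN)//.
  by apply: eq_integral => t _; rewrite opprK.
have mNo : measurable_fun (`]0%R, +oo[%classic : set R) (fun t : R => F (- t)%R) by exact: measurable_funS mFN.
rewrite (integral_itv_obnd_cbnd mNo) h.
rewrite addeC -ge0_integral_setU//.
- congr (integral _ _ _); apply/seteqP; split=> t //= _.
  by rewrite !in_itv /= andbT; have [|] := leP t 0%R; [left|right].
- exact: measurable_funS mF.
- apply/disj_setPS => t /=; rewrite !in_itv /= andbT => -[t1 t2].
  by move: t2; rewrite ltNge t1.
Qed.

Lemma integral_oneDsqr : \int[mu]_m ((1 + m ^+ 2)^-1)%:E = pi%:E.
Proof.
have m1 : measurable_fun [set: R] (fun m : R => ((1 + m ^+ 2)^-1)%:E).
  apply/measurable_EFinP; apply: continuous_measurable_fun => m.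
  exact: continuous_oneDsqrV.
rewrite ge0_integral_halves//; last by move=> t; rewrite lee_fin invr_ge0 addr_ge0// sqr_ge0.
under [X in _ + X = _]eq_integral do rewrite sqrrN.
have mo : measurable_fun (`]0%R, +oo[%classic : set R) (fun m : R => ((1 + m ^+ 2)^-1)%:E).
  exact: measurable_funS m1.
rewrite (integral_itv_obnd_cbnd mo) integral0y_oneDsqr -EFinD.
by congr EFin; field.
Qed.

(** The substitution b = a m with Jacobian |a|, carried out by Tonelli and a dilation of the second
    coordinate for each a > 0. The factor [Num.max a 0] is both the Jacobian and the restriction to
    a > 0; the left half-plane is reflected onto the right one. *)
Lemma ge0_integral_slopes (G : R * R -> \bar R) :
  measurable_fun [set: R * R] G -> (forall z, 0 <= G z) ->
  \int[(mu \x mu)%E]_z G z =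
  \int[mu]_m \int[mu]_a ((Num.max a 0)%:E * G (a, a * m)%R) +
  \int[mu]_m \int[mu]_a ((Num.max a 0)%:E * G (- a, - a * m)%R).
Proof.
move=> mG G0.
have half (H : R * R -> \bar R) : measurable_fun [set: R * R] H -> (forall z, 0 <= H z) ->
  \int[mu]_(a in `]0%R, +oo[) (\int[mu]_b H (a, b)) =
  \int[mu]_m \int[mu]_a ((Num.max a 0)%:E * H (a, a * m)%R).
  move=> mH H0.
  pose K (z : R * R) := (Num.max z.1 0)%:E * H (z.1, z.1 * z.2)%R.
  have mK : measurable_fun [set: R * R] K.
    apply: emeasurable_funM.
      apply/measurable_EFinP; apply: measurable_maxr => //.
    apply: (measurableT_comp mH); apply: measurable_fun_pair => //.
    exact: measurable_funM.
  have K0 z : 0 <= K z by rewrite mule_ge0// lee_fin le_max lexx orbT.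
  transitivity (\int[mu]_a \int[mu]_m K (a, m)); last first.
    exact: (@fubini_tonelli _ _ (measurableTypeR R) (measurableTypeR R) R mu mu K).
  rewrite integral_mkcond; apply: eq_integral => a _; rewrite patchE.
  case: ifPn => [|].
    rewrite inE /= in_itv /= andbT => a0.
    rewrite -[LHS](ge0_integral_dilation a0)//.
      by apply: eq_integral => m _; rewrite /K /= max_l// ltW.
    exact: (measurable_fun_pair2 _ mH).
  rewrite notin_setE /= in_itv /= andbT => /negP; rewrite -leNgt => a0.
  rewrite integral0_eq// => m _.
  by rewrite /K /= max_r// mul0e.
rewrite fubini_tonelli1//=.
rewrite ge0_integral_halves; last 2 first.
- exact: measurable_fun_fubini_tonelli_F.
- by move=> a; apply: integral_ge0.
apply: (congr2 adde); first exact: (half G mG G0).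
pose GN (z : R * R) := G (- z.1, - z.2)%R.
have mGN : measurable_fun [set: R * R] GN.
  apply: (measurableT_comp mG); apply: measurable_fun_pair.
    exact: (measurableT_comp (@oppr_measurable R setT)).
  exact: (measurableT_comp (@oppr_measurable R setT)).
transitivity (\int[mu]_m \int[mu]_a ((Num.max a 0)%:E * GN (a, a * m)%R)); last first.
  by apply: eq_integral => m _; apply: eq_integral => a _; rewrite /GN /= mulNr.
rewrite -(half GN mGN (fun z => G0 _)).
apply: eq_integral => a _.
rewrite /fubini_F -[LHS]ge0_integral_reflection//.
exact: (measurable_fun_pair2 _ mG).
Qed.

End lebesgue_plane.

(** * Weighted area *)

Section weighted_area.
Context {R : realType}.
Local Notation mu := (@lebesgue_measure R).
Variables (f f1 : R -> R).
Hypothesis f_gt0 : forall t : R, 0 <= t -> 0 < f t.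
Hypothesis f_nincr : forall s t : R, 0 <= s -> s <= t -> f t <= f s.
Hypothesis f1_cont : {within `[0, +oo[, continuous f1}.
Hypothesis f_deriv : forall t : R, 0 < t -> is_derive t 1 f (f1 t).
Hypothesis f_deriv0 : (f h - f 0) / h @[h --> 0^'+] --> f1 0.

(** A version of [w] measurable on the whole line; it agrees with [w] for t > 0. *)
Definition density (t : R) : R := if 0 < t then - (f1 t / t) else 0.

Lemma f1_le0 t : 0 < t -> f1 t <= 0.
Proof.
move=> t0; rewrite leNgt; apply/negP => p.
have e0 : 0 < f1 t / 2 by rewrite divr_gt0.
have [d d0 dP] := is_derive_approx (f_deriv t0) e0.
have d2 : 0 < d / 2 by rewrite divr_gt0.
have := dP (t + d / 2); rewrite [t + _]addrC addrK (gtr0_norm d2).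
have d2d : d / 2 < d by move: d0; lra.
move=> /(_ d2d) /ler_normlP[+ _].
have ttd : t <= d / 2 + t by rewrite lerDr ltW.
have := f_nincr (ltW t0) ttd.
by have := mulr_gt0 e0 d2; lra.
Qed.

Lemma density_ge0 t : 0 <= density t.
Proof.
rewrite /density; case: ifP => // t0.
by rewrite -mulNr divr_ge0 ?oppr_ge0 ?f1_le0// ltW.
Qed.

Lemma measurable_density : measurable_fun [set: R] density.
Proof.
have -> : density = ((fun t => - f1 t / t) \_ `]0, +oo[).
  by apply/funext => t; rewrite /density patchE mem_setE in_itv /= andbT mulNr.
apply/(measurable_restrictT _ _).1; first exact: measurable_itv.
apply: open_continuous_measurable_fun; first exact: interval_open.
move=> t; rewrite inE /= in_itv /= andbT => t0.
have [c1 _] := (continuous_within_itvcyP _ _).1 f1_cont.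
have ct : f1 x @[x --> t] --> f1 t by apply: c1; rewrite in_itv /= t0.
apply: cvgM; first exact: cvgN.
by apply: cvgV; [rewrite gt_eqF|exact: cvg_id].
Qed.

Lemma f_right_cont0 : f x @[x --> 0^'+] --> f 0.
Proof.
have id0 : (h : R) @[h --> 0^'+] --> (0 : R).
  by apply: cvg_at_right_filter; exact: cvg_id.
have H : (f h - f 0) / h * h + f 0 @[h --> 0^'+] --> f1 0 * 0 + f 0.
  by apply: cvgD; [exact: (cvgM f_deriv0 id0)|exact: cvg_cst].
rewrite mulr0 add0r in H; apply: cvg_trans H; apply: near_eq_cvg.
near=> h; rewrite /= divfK ?subrK// gt_eqF//.
Unshelve. all: by end_near. Qed.

(** The factor t of polar coordinates cancels the singularity of [density] and leaves - f', to which
    the fundamental theorem of calculus applies. *)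
Lemma integral_density (rho : R) : 0 <= rho ->
  (\int[mu]_(t in `[0%R, rho]) (t * density t)%:E)%E = (f 0 - f rho)%:E.
Proof.
rewrite le_eqVlt => /orP[/eqP <-|rho0].
  by rewrite set_itv1 integral_set1 subrr.
have md : measurable_fun [set: R] (fun t => (t * density t)%:E).
  by apply/measurable_EFinP; apply: measurable_funM => //; exact: measurable_density.
have mdo : measurable_fun (`]0, rho]%classic : set R) (fun t => (t * density t)%:E).
  exact: measurable_funS md.
rewrite -(integral_itv_obnd_cbnd mdo).
have sub : `[0, rho] `<=` (`[0, +oo[ : set R).
  by move=> t /=; rewrite !in_itv /= andbT => /andP[].
have cN : {within `[0, rho], continuous (fun t => - f1 t)}.
  have := continuous_subspaceW sub f1_cont.
  by move=> c t; apply: cvgN; exact: c.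
have mN : measurable_fun (`]0, rho]%classic : set R) (fun t => (- f1 t)%:E).
  apply/measurable_EFinP.
  have mN' : measurable_fun (`[0, rho]%classic : set R) (fun t => - f1 t).
    by apply: subspace_continuous_measurable_fun; [exact: measurable_itv|exact: cN].
  apply: measurable_funS mN' => //.
  by move=> t /=; rewrite !in_itv /= => /andP[/ltW -> ->].
transitivity (\int[mu]_(t in `]0%R, rho]) (- f1 t)%:E)%E.
  apply: eq_integral => t; rewrite inE /= in_itv /= => /andP[t0 _].
  by rewrite /density t0 mulrN mulrCA divff ?mulr1// gt_eqF.
rewrite (integral_itv_obnd_cbnd mN).
have fN (t : R) : 0 < t -> is_derive t (1 : R) (fun s => - f s) (- f1 t).
  by move=> t0; apply: is_deriveN; exact: f_deriv.
rewrite (@continuous_FTC2 _ _ (fun s => - f s) 0 rho)//.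
- by rewrite -EFinB opprK addrC.
- split.
  + by move=> t; rewrite in_itv /= => /andP[t0 _]; have [] := fN _ t0.
  + by apply: cvgN; exact: f_right_cont0.
  + apply: cvg_at_left_filter; apply: cvgN.
    have [d _] := f_deriv rho0.
    by apply: differentiable_continuous; exact/derivable1_diffP.
- move=> t; rewrite in_itv /= => /andP[t0 _].
  by rewrite derive1E; have [_ ->] := fN _ t0.
Qed.

Lemma integral_density_le : (\int[mu]_(t in `[0%R, +oo[) (t * density t)%:E <= (f 0)%:E)%E.
Proof.
have md : measurable_fun [set: R] (fun t => (t * density t)%:E).
  by apply/measurable_EFinP; apply: measurable_funM => //; exact: measurable_density.
pose F (n : nat) : set R := `[0, n%:R]%classic.
have FU : (`[0, +oo[%classic : set R) = \bigcup_n F n.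
  apply/seteqP; split=> t; last by move=> [n _]; rewrite /F /= !in_itv /= andbT => /andP[].
  rewrite set_itvE /= => t0; exists (Num.truncn t).+1 => //.
  rewrite /F /= in_itv /= t0 /=; have /andP[_] := truncn_itv t0; exact: ltW.
have := @ge0_nondecreasing_set_cvg_integral _ (measurableTypeR R) R F (fun t => (t * density t)%:E) mu.
rewrite -FU => /(_ _ _ _ _)/wrap[].
- move=> n m nm; apply/subsetPset => t; rewrite /F /= !in_itv /= => /andP[-> tn].
  by rewrite (le_trans tn)// ler_nat.
- by move=> n; exact: measurable_itv.
- by move=> n; exact: measurable_funS md.
- move=> n t; rewrite /F /= in_itv /= => /andP[t0 _].
  by rewrite lee_fin mulr_ge0// density_ge0.
move=> cvgF; apply: (@closed_cvg _ _ _ _ _ (fun x : \bar R => (x <= (f 0)%:E)%E) _ _ _ cvgF).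
  exact: closed_ereal_ge_ereal.
apply: nearW => n; rewrite integral_density// lee_fin gerBl.
by rewrite ltW// f_gt0.
Qed.

End weighted_area.

Section slope_area.
Context {R : realType}.
Local Notation mu := (@lebesgue_measure R).
Variables (f f1 w : R -> R).
Hypothesis f_gt0 : forall t : R, 0 <= t -> 0 < f t.
Hypothesis f_nincr : forall s t : R, 0 <= s -> s <= t -> f t <= f s.
Hypothesis f1_cont : {within `[0, +oo[, continuous f1}.
Hypothesis f_deriv : forall t : R, 0 < t -> is_derive t 1 f (f1 t).
Hypothesis f_deriv0 : (f h - f 0) / h @[h --> 0^'+] --> f1 0.
Hypothesis wE : forall t : R, 0 < t -> w t = - (derive1 f t / t).
Implicit Types (E : set (R * R)).

Let q (m : R) := Num.sqrt (1 + m ^+ 2).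

Let q_gt0 m : 0 < q m.
Proof. by rewrite sqrtr_gt0 onem2_gt0. Qed.

Let qq m : q m ^+ 2 = 1 + m ^+ 2.
Proof. by rewrite sqr_sqrtr// ltW// onem2_gt0. Qed.

Let md := measurable_density f1_cont.

Let d_ge0 := density_ge0 f_nincr f_deriv.

(** Weighted area of [E] per unit slope along the ray of direction (sg, sg m); a is the Jacobian of
    [ge0_integral_slopes]. *)
Definition slope_area E (sg m : R) : \bar R :=
  (\int[mu]_a ((Num.max a 0)%:E *
     (density f1 (enorm (a *: slope_dir sg m)) * \1_E (a *: slope_dir sg m))%:E))%E.

Lemma measurable_density_indic E : measurable E ->
  measurable_fun [set: R * R] (fun z => (density f1 (enorm z) * \1_E z)%:E).
Proof.
move=> mE; apply/measurable_EFinP; apply: measurable_funM; last exact: measurable_indic.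
apply: (measurableT_comp md).
have -> : @enorm R = Num.sqrt \o (fun z => z.1 * z.1 + z.2 * z.2) by [].
apply: measurableT_comp.
  by apply: continuous_measurable_fun; exact: sqrt_continuous.
by apply: measurable_funD; apply: measurable_funM.
Qed.

Let dI_ge0 E z : (0 <= (density f1 (enorm z) * \1_E z)%:E)%E.
Proof. by rewrite lee_fin mulr_ge0// d_ge0. Qed.

Lemma slope_area_ge0 E sg m : (0 <= slope_area E sg m)%E.
Proof.
apply: integral_ge0 => a _; rewrite mule_ge0// lee_fin.
by rewrite le_max lexx orbT.
Qed.

Lemma measurable_slope_dir E sg m (c : R) : measurable E ->
  measurable_fun [set: R] (fun a => \1_E ((a * c) *: slope_dir sg m) : R).
Proof.
move=> mE; apply: (@measurableT_comp _ _ _ _ _ _ (\1_E : R * R -> R)).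
  exact: measurable_indic.
apply: measurable_fun_pair.
  by apply: measurable_funM => //; apply: measurable_funM.
by apply: measurable_funM => //; apply: measurable_funM.
Qed.

(** The substitution t = q a passes to the distance from the origin and turns a da into t dt / (1 +
    m^2). *)
Lemma slope_area_radial E sg m : sg ^+ 2 = 1 -> measurable E ->
  slope_area E sg m = (\int[mu]_t
    (Num.max t 0 * density f1 t * \1_E ((t / q m) *: slope_dir sg m) / (1 + m ^+ 2))%:E)%E.
Proof.
move=> sg1 mE; rewrite -[RHS](ge0_integral_dilation (q_gt0 m)).
- apply: eq_integral => a _; rewrite -!EFinM; congr EFin.
  have qn0 : q m != 0 by rewrite gt_eqF.
  rewrite -qq [q m * a / q m]mulrC mulKf//.
  have [a0|a0] := ltP 0 a; last first.
    have qa0 : q m * a <= 0 by rewrite pmulr_rle0.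
    by rewrite (max_r qa0) !mul0r mulr0.
  have qa0 : 0 < q m * a := mulr_gt0 (q_gt0 m) a0.
  rewrite (max_l (ltW qa0)).
  rewrite enormZ enorm_slope_dir// gtr0_norm// [a * q m]mulrC.
  by field.
- apply/measurable_EFinP; apply: measurable_funM => //; apply: measurable_funM.
    by apply: measurable_funM => //; apply: measurable_maxr.
  exact: measurable_slope_dir.
- move=> t; rewrite lee_fin divr_ge0 ?(ltW (onem2_gt0 m))// !mulr_ge0// ?d_ge0//.
  by rewrite le_max lexx orbT.
Qed.

Let measurable_td : measurable_fun [set: R] (fun t => (t * density f1 t)%:E).
Proof. by apply/measurable_EFinP; apply: measurable_funM. Qed.

Lemma slope_area_le E sg m (D : set R) : sg ^+ 2 = 1 -> measurable E -> measurable D ->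
  (forall t, 0 < t -> E ((t / q m) *: slope_dir sg m) -> D t) ->
  D `<=` [set t | 0 <= t] ->
  (slope_area E sg m <=
   (1 + m ^+ 2)^-1%:E * \int[mu]_(t in D) (t * density f1 t)%:E)%E.
Proof.
move=> sg1 mE mD ED D0; rewrite slope_area_radial//.
have m2 := onem2_gt0 m.
have mf1 : measurable_fun [set: R] (fun t => (Num.max t 0 * density f1 t *
    \1_E ((t / q m) *: slope_dir sg m) / (1 + m ^+ 2))%:E).
  apply/measurable_EFinP; apply: measurable_funM => //; apply: measurable_funM.
    by apply: measurable_funM => //; apply: measurable_maxr.
  exact: measurable_slope_dir.
have mtD : measurable_fun D (fun t => (t * density f1 t)%:E).
  exact: measurable_funS measurable_td.
have tD0 t : D t -> (0 <= (t * density f1 t)%:E)%E.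
  by move=> /D0 t0; rewrite lee_fin mulr_ge0// d_ge0.
have k0 : (0 <= ((1 + m ^+ 2)^-1)%:E)%E by rewrite lee_fin invr_ge0 ltW.
rewrite -ge0_integralZl// [leRHS]integral_mkcond; apply: ge0_le_integral => //.
- move=> t _; rewrite lee_fin divr_ge0 ?(ltW m2)// !mulr_ge0// ?d_ge0//.
  by rewrite le_max lexx orbT.
- apply/(measurable_restrictT _ _).1 => //.
  by apply: emeasurable_funM => //; exact: measurable_cst.
move=> t _; rewrite patchE; case: ifPn => [|].
  rewrite inE => Dt; have t0 := D0 t Dt.
  rewrite max_l// -EFinM lee_fin mulrC ler_pM2l ?invr_gt0//.
  by rewrite ler_piMr ?mulr_ge0 ?d_ge0.
rewrite notin_setE => nDt; have [t0|t0] := ltP 0 t; last by rewrite !mul0r.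
rewrite indicE memNset ?mulr0 ?mul0r// => /(ED t t0).
exact: nDt.
Qed.

Lemma slope_area_le_radius E sg m (rho : R) : sg ^+ 2 = 1 -> measurable E -> 0 <= rho ->
  (forall t, 0 < t -> E ((t / q m) *: slope_dir sg m) -> t <= rho) ->
  (slope_area E sg m <= ((f 0 - f rho) / (1 + m ^+ 2))%:E)%E.
Proof.
move=> sg1 mE rho0 Erho.
rewrite mulrC EFinM -(integral_density f1_cont f_deriv f_deriv0 rho0).
apply: slope_area_le => //.
- by move=> t t0 /(Erho t t0) le; rewrite /= in_itv /= (ltW t0).
- by move=> t /=; rewrite in_itv /= => /andP[].
Qed.

Lemma slope_area_le_total E sg m : sg ^+ 2 = 1 -> measurable E ->
  (slope_area E sg m <= (f 0 / (1 + m ^+ 2))%:E)%E.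
Proof.
move=> sg1 mE; have m2 := onem2_gt0 m.
apply: (@le_trans _ _ (((1 + m ^+ 2)^-1)%:E * \int[mu]_(t in `[0%R, +oo[) (t * density f1 t)%:E)%E).
  apply: slope_area_le => //.
  - by move=> t t0 _; rewrite /= in_itv /= (ltW t0).
  - by move=> t /=; rewrite in_itv /= andbT.
rewrite [f 0 / _]mulrC EFinM lee_pmul2l ?lte_fin ?invr_gt0//.
exact: integral_density_le.
Qed.

Lemma slope_area_eball (r : R) sg m : sg ^+ 2 = 1 -> 0 < r ->
  slope_area (eball r) sg m = ((f 0 - f r) / (1 + m ^+ 2))%:E.
Proof.
move=> sg1 r0; have m2 := onem2_gt0 m.
have mE : measurable (eball r) by apply: open_measurable_plane; exact: open_eball.
rewrite slope_area_radial// mulrC EFinM.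
rewrite -(integral_density f1_cont f_deriv f_deriv0 (ltW r0)).
have mo : measurable_fun (`[0, r[%classic : set R) (fun t => (t * density f1 t)%:E).
  exact: measurable_funS measurable_td.
rewrite -(integral_itv_bndo_bndc mo).
have td0 t : `[0, r[%classic t -> (0 <= (t * density f1 t)%:E)%E.
  by rewrite /= in_itv /= => /andP[t0 _]; rewrite lee_fin mulr_ge0// d_ge0.
have k0 : (0 <= ((1 + m ^+ 2)^-1)%:E)%E by rewrite lee_fin invr_ge0 ltW.
rewrite -ge0_integralZl//.
rewrite [RHS]integral_mkcond; apply: eq_integral => t _; rewrite patchE.
have [t0|t0] := ltP 0 t; last first.
  rewrite !mul0r; case: ifPn => //; rewrite inE /= in_itv /= => /andP[t0' _].
  have -> : t = 0 by apply/eqP; rewrite eq_le t0 t0'.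
  by rewrite mul0r mule0.
have inball : (\1_(eball r) ((t / q m) *: slope_dir sg m) : R) = (t < r)%R%:R.
  rewrite indicE; congr (_%:R); congr (nat_of_bool _).
  apply/idP/idP; rewrite inE /eball /= enormZ enorm_slope_dir// gtr0_norm ?divr_gt0//;
  by rewrite divfK// gt_eqF.
rewrite inball mem_setE in_itv /= (ltW t0) /=; case: ifP => _.
  by rewrite -EFinM mulr1 mulrC.
by rewrite mulr0 mul0r.
Qed.

Lemma weighted_area_slopes E : measurable E ->
  weighted_area w E = (\int[mu]_m slope_area E 1 m + \int[mu]_m slope_area E (-1) m)%E.
Proof.
move=> mE.
pose G z := (density f1 (enorm z) * \1_E z)%:E.
have mG : measurable_fun [set: R * R] G by exact: measurable_density_indic.
have -> : weighted_area w E = (\int[(mu \x mu)%E]_z G z)%E.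
  rewrite /weighted_area integral_mkcond.
  have m0 : measurable [set (0 : R * R)].
    have -> : [set (0 : R * R)] = [set 0] `*` [set 0].
      by apply/seteqP; split=> [z -> //|[a b] /= [-> ->]].
    by apply: measurableX; exact: measurable_set1.
  (* The value [w 0] is arbitrary, whereas [density] is 0 there; the difference is carried by the
     origin, a null set. *)
  have hE : ((fun x => (w (enorm x))%:E) \_ E) =
      (fun z => (density f1 (enorm z) * \1_E z + w 0 * \1_E 0 * \1_[set 0] z)%:E).
    apply/funext => z; rewrite patchE !indicE; have [->|z0] := eqVneq z 0.
      have -> : (0 : R * R) \in [set 0] by rewrite inE.
      rewrite enorm0 /density ltxx mul0r add0r mulr1.
      by case: ifP; rewrite ?mulr1 ?mulr0.
    have z1 : (z \in [set 0]) = false.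
      by apply/negP; rewrite inE; move/eqP: z0.
    rewrite z1 mulr0 addr0; case: ifP => _; rewrite ?mulr1 ?mulr0//.
    have ez := enorm_gt0 z0; rewrite /density ez wE//.
    by have [_ <-] := f_deriv ez; rewrite derive1E.
  rewrite hE; apply: ae_eq_integral => //.
  - apply/measurable_EFinP; apply: measurable_funD; first exact/measurable_EFinP.
    by apply: measurable_funM => //; exact: measurable_indic.
  exists [set 0]; split => //.
    have -> : [set (0 : R * R)] = [set 0] `*` [set 0].
      by apply/seteqP; split=> [z -> //|[a b] /= [-> ->]].
    transitivity (mu [set 0%R] * mu [set 0%R])%E.
      by apply: (@product_measure1E _ _ (measurableTypeR R) (measurableTypeR R));
        exact: measurable_set1.
    by rewrite lebesgue_measure_set1 mul0e.
  move=> z /=; apply: contra_notP => z0 _; rewrite /G.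
  have -> : \1_[set 0] z = 0 :> R.
    rewrite indicE; have -> // : (z \in [set 0]) = false.
    by apply/negP; rewrite inE; exact: z0.
  by rewrite mulr0 addr0.
rewrite (ge0_integral_slopes mG (dI_ge0 E)).
apply: (congr2 adde); apply: eq_integral => m _; apply: eq_integral => a _;
  rewrite /G; congr (_ * (density f1 (enorm _) * \1_E _)%:E)%E;
  by congr pair; rewrite /= /GRing.scale /=; ring.
Qed.

Lemma measurable_slope_area E sg : measurable E -> measurable_fun [set: R] (slope_area E sg).
Proof.
move=> mE.
pose K (z : R * R) := ((Num.max z.1 0)%:E *
     (density f1 (enorm (z.1 *: slope_dir sg z.2)) * \1_E (z.1 *: slope_dir sg z.2))%:E)%E.
have mK : measurable_fun [set: R * R] K.
  apply: emeasurable_funM.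
    by apply/measurable_EFinP; apply: measurable_maxr.
  apply: (measurableT_comp (measurable_density_indic mE)).
  apply: measurable_fun_pair; apply: measurable_funM => //.
  exact: measurable_funM.
have K0 z : (0 <= K z)%E.
  by rewrite mule_ge0// lee_fin le_max lexx orbT.
exact: (@measurable_fun_fubini_tonelli_G _ _ (measurableTypeR R) (measurableTypeR R) R mu K).
Qed.

Lemma integral_cauchy_density (c : R) : 0 <= c ->
  (\int[mu]_m (c / (1 + m ^+ 2))%:E)%E = (c * pi)%:E.
Proof.
move=> c0; under eq_integral do rewrite EFinM.
rewrite ge0_integralZl//.
- by rewrite integral_oneDsqr -EFinM.
- apply/measurable_EFinP; apply: continuous_measurable_fun => m.
  exact: continuous_oneDsqrV.
- by move=> m _; rewrite lee_fin invr_ge0 ltW// onem2_gt0.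
Qed.

Lemma weighted_area_eball (r : R) : 0 < r ->
  weighted_area w (eball r) = (2 * pi * (f 0 - f r))%:E.
Proof.
move=> r0; rewrite weighted_area_slopes; last first.
  by apply: open_measurable_plane; exact: open_eball.
have fr : 0 <= f 0 - f r by rewrite subr_ge0 f_nincr// ltW.
under eq_integral do rewrite slope_area_eball ?expr1n//.
under [X in (_ + X)%E]eq_integral do rewrite slope_area_eball ?sqrrN ?expr1n//.
rewrite integral_cauchy_density// -EFinD; congr EFin; ring.
Qed.

End slope_area.

(** * Integrals against the Hausdorff measure *)

Section raw_integral.
Context {R : realType}.
Local Open Scope ereal_scope.
Implicit Types (A D : set (R * R)) (g : R * R -> \bar R).

Lemma hausdorff1_set0 : hausdorff1 (set0 : set (R * R)) = 0.
Proof.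
apply/eqP; rewrite eq_le hausdorff1_ge0 andbT.
apply: ge_ereal_sup => _ [d /= d0 <-].
by rewrite hausdorff1_pre_subsingleton.
Qed.

Lemma sintegral_hausdorff1E (h : {nnsfun (R * R) >-> R}) :
  sintegral hausdorff1 h =
  \sum_(c \in range h) (c%:E * hausdorff1 (h @^-1` [set c])).
Proof.
apply/esym; apply: fsbig_widen => // c [_ /= hc].
have -> : h @^-1` [set c] = set0.
  by apply/seteqP; split=> // x hx; apply: hc; exists x.
by rewrite hausdorff1_set0 mule0.
Qed.

Lemma sintegral_hausdorff1_ge0 (h : {nnsfun (R * R) >-> R}) :
  0 <= sintegral hausdorff1 h.
Proof.
rewrite sintegral_hausdorff1E; apply: fsume_ge0 => _ [x _ <-].
by rewrite mule_ge0 ?hausdorff1_ge0// lee_fin.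
Qed.

Lemma integral_hausdorff1_le D g (B : \bar R) :
  (forall h : {nnsfun (R * R) >-> R},
    (forall x, (h x)%:E <= (g \_ D)^\+ x) -> sintegral hausdorff1 h <= B) ->
  \int[hausdorff1]_(x in D) g x <= B.
Proof.
move=> H; rewrite /integral.
set P := ereal_sup _; set Q := ereal_sup _.
have PB : P <= B by apply: ge_ereal_sup => _ [h /= hg <-]; exact: H.
apply: le_trans PB; rewrite geeDl// oppe_le0.
apply: (le_trans (sintegral_hausdorff1_ge0 nnsfun0)).
apply: ereal_sup_ubound; exists nnsfun0 => //= x.
by rewrite funenegE le_max lexx orbT.
Qed.

(** The integrand restricted to [D] is itself simple and competes in the first supremum; the
    supremum for the negative part is 0. *)
Lemma integral_hausdorff1_cst_ge D g (c : R) : measurable D -> (0 < c)%R ->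
  (forall x, D x -> g x = c%:E) ->
  c%:E * hausdorff1 D <= \int[hausdorff1]_(x in D) g x.
Proof.
move=> mD c0 gc; rewrite /integral.
set P := ereal_sup _; set Q := ereal_sup _.
have gD x : (g \_ D) x = (c * \1_D x)%:E.
  by rewrite patchE indicE; case: ifPn => [|_]; rewrite ?mulr0// inE mulr1 => /gc.
have Q0 : Q = 0.
  apply/eqP; rewrite eq_le; apply/andP; split.
    apply: ge_ereal_sup => _ [h /= hg <-].
    have h0 x : h x = 0%R.
      apply/eqP; rewrite eq_le fun_ge0 andbT -lee_fin (le_trans (hg x))//.
      by rewrite funenegE gD -EFinN ge_max lexx andbT lee_fin oppr_le0 mulr_ge0// ltW.
    rewrite sintegral_hausdorff1E.
    rewrite fsbig1// => _ [x _ <-].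
    by rewrite h0 mul0e.
  apply: (le_trans (sintegral_hausdorff1_ge0 nnsfun0)).
  apply: ereal_sup_ubound; exists nnsfun0 => //= x.
  by rewrite funenegE le_max lexx orbT.
rewrite Q0 sube0.
pose h := scale_nnsfun (indic_nnsfun R mD) (ltW c0).
have hE x : h x = (c * \1_D x)%R by [].
apply: (@le_trans _ _ (sintegral hausdorff1 h)); last first.
  apply: ereal_sup_ubound; exists h => //= x.
  by rewrite funeposE gD le_max lexx.
have -> : sintegral hausdorff1 h = \sum_(x \in [set c]) (x%:E * hausdorff1 (h @^-1` [set x])).
  apply/esym; apply: fsbig_widen => // x [_ /= xc].
  have [->|x0] := eqVneq x 0%R; first by rewrite mul0e.
  have -> : h @^-1` [set x] = set0.
    apply/seteqP; split=> // y hy; have {hy} : h y = x by exact: hy.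
    rewrite hE indicE.
    by case: (_ \in _); rewrite ?mulr1 ?mulr0 => /esym// /eqP; rewrite (negbTE x0).
  by rewrite hausdorff1_set0 mule0.
rewrite fsbig_set1; have -> // : h @^-1` [set c] = D.
apply/seteqP; split=> y.
  move=> hy; have {hy} : h y = c by exact: hy.
  rewrite hE indicE; have [|_] := boolP (y \in D); first by rewrite inE.
  by rewrite mulr0 => /esym/eqP; rewrite gt_eqF.
by move=> Dy; rewrite -[_ y]/(h y = c) hE indicE mem_set// mulr1.
Qed.

End raw_integral.

(** * Lower bound for the disc *)

Section ball_side.
Context {R : realType}.

Lemma weighted_curvature_eball_ge (f : R -> R) (r : R) : 0 < r -> 0 < f r ->
  ((2 * pi * f r)%:E <= weighted_curvature f (eball r))%E.
Proof.
move=> r0 fr0; rewrite /weighted_curvature boundary_eball//.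
have mC : measurable [set x : R * R | enorm x = r].
  have -> : [set x : R * R | enorm x = r] = closure (eball r) `\` eball r.
    by rewrite -boundary_openE ?boundary_eball//; exact: open_eball.
  apply: measurableD; last by apply: open_measurable_plane; exact: open_eball.
  rewrite -[closure _]setCK; apply: measurableC; apply: open_measurable_plane.
  by rewrite openC; exact: closed_closure.
have c0 : 0 < r^-1 * f r by rewrite mulr_gt0// invr_gt0.
have := integral_hausdorff1_cst_ge (g := fun x => (curvature (eball r) x * f (enorm x))%:E) mC c0.
move=> /(_ _)/wrap[|]; first by move=> x /= xr; rewrite curvature_eball// xr.
apply: le_trans.
have := hausdorff1_circle_ge r0.
rewrite -(@lee_pmul2l _ (r^-1 * f r)%:E)// ?lte_fin//.
apply: le_trans; rewrite -EFinM lee_fin.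
have -> : r^-1 * f r * (2 * pi * r) = 2 * pi * f r; last by [].
by field; rewrite gt_eqF.
Qed.

End ball_side.

(** * Upper bound for a convex set *)

Section total_curvature.
Context {R : realType}.
Local Notation mu := (@lebesgue_measure R).
Variables (f f1 w : R -> R) (E : set (R * R)).
Hypothesis f_gt0 : forall t : R, 0 <= t -> 0 < f t.
Hypothesis f_nincr : forall s t : R, 0 <= s -> s <= t -> f t <= f s.
Hypothesis f1_cont : {within `[0, +oo[, continuous f1}.
Hypothesis f_deriv : forall t : R, 0 < t -> is_derive t 1 f (f1 t).
Hypothesis f_deriv0 : (f h - f 0) / h @[h --> 0^'+] --> f1 0.
Hypothesis wE : forall t : R, 0 < t -> w t = - (derive1 f t / t).
Hypothesis E_convex : convex_set E.
Hypothesis E_open : open E.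

Let mE : measurable E.
Proof. exact: open_measurable_plane. Qed.

Let normal_at (sg : R) (x : R * R) (m : R) := supports E (slope_dir sg m) x.

Let normal_at_closed sg (X1 X2 : R -> R) : continuous X1 -> continuous X2 ->
  closed [set m | normal_at sg (X1 m, X2 m) m].
Proof.
move=> c1 c2.
have -> : [set m | normal_at sg (X1 m, X2 m) m] =
  (fun m => (X1 m, X2 m)) @^-1` closure E `&`
  \bigcap_(z in E) ((fun m => dotp (z - (X1 m, X2 m)) (slope_dir sg m)) @^-1`
                    [set t | t <= 0]).
  by [].
apply: closedI.
  apply: preimage_closed; last exact: closed_closure.
  by move=> m _; exact: (cvg_pair (c1 m) (c2 m)).
apply: closed_bigI => z _; apply: preimage_closed; last exact: closed_le.
move=> m _; rewrite /dotp /=.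
apply: cvgD; apply: cvgM.
- by apply: cvgB; [exact: cvg_cst|exact: c1].
- exact: cvg_cst.
- by apply: cvgB; [exact: cvg_cst|exact: c2].
- by apply: cvgM; [exact: cvg_cst|exact: cvg_id].
Qed.

(* The weight f |x| dm / (1 + m^2) of the Gauss map is dominated by this density,
   whatever the boundary point x of normal slope m: the ray of slope m meets E
   only at distances at most |x| from the origin. *)
Definition slope_density (sg m : R) : R :=
  f 0 / (1 + m ^+ 2) - fine (slope_area f1 E sg m).

Let area_fin sg m : sg ^+ 2 = 1 -> slope_area f1 E sg m \is a fin_num.
Proof.
move=> sg1; rewrite ge0_fin_numE; last exact: slope_area_ge0.
apply: (le_lt_trans _ (ltry (f 0 / (1 + m ^+ 2)))).
exact: (slope_area_le_total f_gt0).
Qed.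

Let slope_densityE sg m : sg ^+ 2 = 1 ->
  (slope_density sg m)%:E = ((f 0 / (1 + m ^+ 2))%:E - slope_area f1 E sg m)%E.
Proof. by move=> sg1; rewrite /slope_density EFinB fineK// area_fin. Qed.

Let slope_density_ge0 sg m : sg ^+ 2 = 1 -> 0 <= slope_density sg m.
Proof.
move=> sg1; rewrite subr_ge0 -lee_fin fineK ?area_fin//.
exact: (slope_area_le_total f_gt0).
Qed.

Let measurable_slope_density sg : measurable_fun [set: R] (slope_density sg).
Proof.
apply: measurable_funB.
  apply: measurable_funM => //; apply: continuous_measurable_fun => m.
  exact: continuous_oneDsqrV.
apply: (measurableT_comp (@fine_measurable R setT measurableT)).
exact: measurable_slope_area.
Qed.

Lemma slope_density_ge sg x m : sg ^+ 2 = 1 -> supports E (slope_dir sg m) x ->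
  f (enorm x) / (1 + m ^+ 2) <= slope_density sg m.
Proof.
move=> sg1 [_ sx]; rewrite lerBrDl -lerBrDr -mulrBl.
rewrite -lee_fin fineK ?area_fin//; apply: slope_area_le_radius => //.
  exact: enorm_ge0.
move=> t t0 /sx; rewrite dotpBl dotpZl subr_le0 -sqr_enorm enorm_slope_dir//.
have q0 : 0 < Num.sqrt (1 + m ^+ 2) by rewrite sqrtr_gt0 onem2_gt0.
rewrite expr2 mulrA divfK ?gt_eqF// => le.
rewrite -(ler_pM2r q0) (le_trans le)// (le_trans (dotp_le _ _))//.
by rewrite enorm_slope_dir.
Qed.

Lemma integral_slope_density (r : R) : 0 < r ->
  weighted_area w E = weighted_area w (eball r) ->
  (\int[mu]_m (slope_density 1 m)%:E + \int[mu]_m (slope_density (-1) m)%:E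
   = (2 * pi * f r)%:E)%E.
Proof.
move=> r0 EA.
have one sg : sg ^+ 2 = 1 -> (\int[mu]_m (slope_density sg m)%:E +
    \int[mu]_m slope_area f1 E sg m = (f 0 * pi)%:E)%E.
  move=> sg1; rewrite -integral_cauchy_density ?(ltW (f_gt0 _))//.
  have p0 m : [set: R] m -> (0 <= (slope_density sg m)%:E)%E.
    by move=> _; rewrite lee_fin slope_density_ge0.
  have a0 m : [set: R] m -> (0 <= slope_area f1 E sg m)%E.
    by move=> _; exact: slope_area_ge0.
  have mp : measurable_fun [set: R] (fun m => (slope_density sg m)%:E).
    exact/measurable_EFinP.
  have ma : measurable_fun [set: R] (slope_area f1 E sg) by exact: measurable_slope_area.
  rewrite -(ge0_integralD mu measurableT p0 mp a0 ma).
  apply: eq_integral => m _; rewrite slope_densityE// subeK//; exact: area_fin.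
have h1 := one 1 (expr1n _ _).
have h2 : (-1 : R) ^+ 2 = 1 by rewrite sqrrN expr1n.
have {}h2 := one (-1) h2.
have := weighted_area_slopes f_nincr f1_cont f_deriv wE mE.
rewrite EA (weighted_area_eball f_nincr f1_cont f_deriv f_deriv0 wE r0).
move: h1 h2.
move: (integral _ _ _) (integral _ _ _) (integral _ _ _) (integral _ _ _).
(* Each of the three identities has a finite side, so all four integrals are real numbers. *)
move=> [p1| |] [a1| |] [p2| |] [a2| |] //= [e1] [e2] [e3].
by rewrite -EFinD; congr EFin; move: e1 e2 e3; lra.
Qed.

(** A positive value cannot be the default 0 of [xget]. *)
Lemma is_curvature_curvature x : 0 < curvature E x -> is_curvature E x (curvature E x).
Proof.
move=> h0; apply: (@xgetPex _ 0 [set h | is_curvature E x h]).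
apply: contrapT => nh; move: h0; rewrite /curvature xgetPN ?ltxx// => h Hh.
by apply: nh; exists h.
Qed.

(** From a [slope_density] < c <= H f(|x|) and f(|x|) / (1 + m^2) <= [slope_density] the weight
    cancels, leaving a < H (1 + m^2), which is what [curvature_slope] asks for. *)
Let slope_expanding sg (A : set (R * R)) (c : R) x m a :
  sg ^+ 2 = 1 -> (forall x, A x -> 0 < curvature E x /\ c <= curvature E x * f (enorm x)) ->
  A x -> supports E (slope_dir sg m) x -> 0 < a -> a * slope_density sg m < c ->
  exists2 d, 0 < d & forall y m', supports E (slope_dir sg m') y ->
    enorm (y - x) < d -> a * enorm (y - x) <= `|m' - m|.
Proof.
move=> sg1 AP Ax sx a0 ac; have [h0 ch] := AP x Ax.
have hx := is_curvature_curvature h0.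
apply: (curvature_slope E_open hx sg1 a0 _ sx).
have fx := f_gt0 (enorm_ge0 x); have m2 := onem2_gt0 m.
have := slope_density_ge sg1 sx; rewrite -(ler_pM2l a0) => le.
have := lt_le_trans (le_lt_trans le ac) ch.
by rewrite mulrA ltr_pdivrMr// mulrAC ltr_pM2r.
Qed.

Let curved_point_unique n (A : set (R * R)) x y :
  (forall x, A x -> 0 < curvature E x) -> n != 0 ->
  A x -> supports E n x -> supports E n y -> x = y.
Proof.
move=> AP n0 Ax sx sy; have h0 := AP x Ax.
apply/esym; apply: (curvature_supports_unique E_convex E_open _ _ n0 sx sy).
  exact: is_curvature_curvature h0.
by rewrite gt_eqF.
Qed.

Let supportsZ n x (k : R) : 0 < k -> supports E n x -> supports E (k *: n) x.
Proof.
move=> k0 [cx sx]; split => // y /sx.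
by rewrite !(dotpC _ n) !(dotpC _ (_ *: _)) dotpZl pmulr_rle0.
Qed.

(** The normal nu - u' tau of a local representation is divided by the absolute value of its first
    coordinate, or of the second one when the first vanishes. *)
Let supports_cases x : boundary E x -> 0 < curvature E x ->
  [\/ exists m, supports E (slope_dir 1 m) x,
      exists m, supports E (slope_dir (-1) m) x,
      supports E (0, 1) x | supports E (0, -1) x].
Proof.
move=> bx /is_curvature_curvature [tau [nu [u [H _]]]].
have := supports_subgraph E_convex bx E_open H.
have [tt nn tn _ _] := H.
have : nu - derive1 u 0 *: tau != 0.
  apply/eqP => n0; have : dotp (nu - derive1 u 0 *: tau) nu = 1.
    by rewrite dotpBl dotpZl nn tn mulr0 subr0.
  by rewrite n0 /dotp /= !mul0r addr0 => /esym/eqP; rewrite oner_eq0.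
case: (nu - _) => n1 n2 n0 sx.
have [n1lt|n1gt|n10] := ltgtP n1 0.
- apply: Or42; exists (n2 / n1).
  have := supportsZ _ sx (k := - n1^-1); rewrite oppr_gt0 invr_lt0 => /(_ n1lt).
  congr (supports E _ x); congr pair; rewrite /= /GRing.scale /=;
    by field; rewrite lt_eqF.
- apply: Or41; exists (n2 / n1).
  have := supportsZ _ sx (k := n1^-1); rewrite invr_gt0 => /(_ n1gt).
  congr (supports E _ x); congr pair; rewrite /= /GRing.scale /=;
    by field; rewrite gt_eqF.
- move: n0 sx; rewrite n10 => n0 sx.
  have [n2lt|n2gt|n20] := ltgtP n2 0; last by move: n0; rewrite n20 eqxx.
    apply: Or44; have := supportsZ _ sx (k := - n2^-1); rewrite oppr_gt0 invr_lt0 => /(_ n2lt).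
    congr (supports E _ x); congr pair; rewrite /= /GRing.scale /=;
      by field; rewrite lt_eqF.
  apply: Or43; have := supportsZ _ sx (k := n2^-1); rewrite invr_gt0 => /(_ n2gt).
  congr (supports E _ x); congr pair; rewrite /= /GRing.scale /=;
    by field; rewrite gt_eqF.
Qed.

(** The piece is split according to the sign of the first coordinate of the normal. This is done at
    fixed delta with a bound independent of delta, which then passes to the supremum. *)
Lemma hausdorff1_curved_le (A : set (R * R)) (c : R) : 0 < c -> measurable A ->
  A `<=` boundary E ->
  (forall x, A x -> 0 < curvature E x /\ c <= curvature E x * f (enorm x)) ->
  [/\ measurable (slopes_over (normal_at 1) A),
      measurable (slopes_over (normal_at (-1)) A) &
      (c%:E * hausdorff1 A <=
       \int[mu]_(m in slopes_over (normal_at 1) A) (slope_density 1 m)%:E +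
       \int[mu]_(m in slopes_over (normal_at (-1)) A) (slope_density (-1) m)%:E)%E].
Proof.
move=> c0 mA AE AP.
have A0 x (Ax : A x) : 0 < curvature E x := (AP x Ax).1.
have s1 : (1 : R) ^+ 2 = 1 by rewrite expr1n.
have s2 : (-1 : R) ^+ 2 = 1 by rewrite sqrrN expr1n.
have pos sg x m : sg ^+ 2 = 1 -> A x -> normal_at sg x m -> 0 < slope_density sg m.
  move=> sg1 _ sx; apply: lt_le_trans (slope_density_ge sg1 sx).
  by rewrite divr_gt0 ?onem2_gt0// f_gt0// enorm_ge0.
have expd sg sg1 := fun x m a => @slope_expanding sg A c x m a sg1 AP.
have inj sg x y m : sg ^+ 2 = 1 -> A x -> A y -> normal_at sg x m -> normal_at sg y m -> x = y.
  by move=> sg1 Ax _; apply: curved_point_unique Ax => //; exact: slope_dir_neq0.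
have meas sg : sg ^+ 2 = 1 -> measurable (slopes_over (normal_at sg) A).
  move=> sg1; apply: (measurable_slopes_over (Phi := slope_density sg) ltr01 c0) => //.
  - exact: normal_at_closed.
  - by move=> x m; exact: pos.
  - exact: expd.
have core sg d : sg ^+ 2 = 1 -> 0 < d ->
    (c%:E * hausdorff1_pre d (A `&` [set x | exists m, normal_at sg x m]) <=
    \int[mu]_(m in slopes_over (normal_at sg) A) (slope_density sg m)%:E)%E.
  move=> sg1 d0; apply: hausdorff1_pre_le_integral_slopes => //.
  - exact: normal_at_closed.
  - by move=> x m; exact: pos.
  - exact: expd.
  - by move=> x y m; exact: inj.
split; [exact: meas|exact: meas|].
set B := (_ + _)%E.
rewrite -lee_pdivlMl//; apply: ge_ereal_sup => _ [d /= d0 <-].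
rewrite lee_pdivlMl//.
(* Each vertical normal belongs to at most one curved point, and [hausdorff1_pre] does not see
   single points. *)
pose V s := A `&` [set x | supports E (0, s) x].
have V0 s : s != 0 -> hausdorff1_pre d (V s) = 0%E.
  move=> s0; apply: hausdorff1_pre_subsingleton => // x y [Ax sx] [_ sy].
  apply: curved_point_unique Ax sx sy => //.
  by apply: contra s0 => /eqP[->].
have cover : A `<=` (A `&` [set x | exists m, normal_at 1 x m]) `|`
    (A `&` [set x | exists m, normal_at (-1) x m]) `|` (V 1 `|` V (-1)).
  move=> x Ax; have [] := supports_cases (AE x Ax) (A0 x Ax) => sx.
  - by left; left.
  - by left; right.
  - by right; left.
  - by right; right.
have le1 : (hausdorff1_pre d A <=
    hausdorff1_pre d (A `&` [set x | exists m, normal_at 1 x m]) +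
    hausdorff1_pre d (A `&` [set x | exists m, normal_at (-1) x m]))%E.
  apply: (le_trans (le_hausdorff1_pre d cover)).
  apply: (le_trans (hausdorff1_preU d _ _)).
  rewrite -[leRHS]adde0; apply: leeD; first exact: hausdorff1_preU.
  apply: (le_trans (hausdorff1_preU d _ _)).
  by rewrite !V0 ?adde0// ?oner_eq0// oppr_eq0 oner_eq0.
apply: (@le_trans _ _ (c%:E * (hausdorff1_pre d (A `&` [set x | exists m, normal_at 1 x m]) +
    hausdorff1_pre d (A `&` [set x | exists m, normal_at (-1) x m])))%E).
  by rewrite lee_pmul2l ?lte_fin.
rewrite ge0_muleDr ?hausdorff1_pre_ge0//.
by apply: leeD; exact: core.
Qed.

(** Each positive level of a simple function below the integrand is bounded by integrals over its
    slopes. The sets of slopes of different levels are disjoint, so the sum is at most the total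
    integral of [slope_density] over both signs. *)
Lemma weighted_curvature_le (r : R) : 0 < r ->
  weighted_area w E = weighted_area w (eball r) ->
  (weighted_curvature f E <= (2 * pi * f r)%:E)%E.
Proof.
move=> r0 EA; apply: integral_hausdorff1_le => h hg.
rewrite -(integral_slope_density r0 EA) sintegral_hausdorff1E.
have fin : finite_set (range h) by exact: fimfunP.
rewrite fsbig_finite//=.
set s := finmap.enum_fset (fset_set (range h)).
pose A c := h @^-1` [set c].
have hA c x : 0 < c -> A c x -> [/\ boundary E x, 0 < curvature E x &
    c <= curvature E x * f (enorm x)].
  move=> c0 hx; have := hg x; rewrite hx funeposE patchE.
  have nomax : (c%:E <= maxe 0 0 :> \bar R)%E -> False.
    by rewrite maxxx lee_fin leNgt c0.
  case: ifPn => [|_ /nomax//]; rewrite inE => bx.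
  rewrite le_max lee_fin [X in _ || X]lee_fin [X in _ || X]leNgt c0 orbF => ch.
  split => //; have fx := f_gt0 (enorm_ge0 x).
  by rewrite -(pmulr_lgt0 _ fx) (lt_le_trans c0).
(* The level 0 contributes nothing; the empty set keeps the family measurable and disjoint. *)
pose M sg c := if 0 < c then slopes_over (normal_at sg) (A c) else set0.
have mA c : measurable (A c) by exact: measurable_funPTI.
have key c : 0 < c -> [/\ measurable (slopes_over (normal_at 1) (A c)),
      measurable (slopes_over (normal_at (-1)) (A c)) &
      (c%:E * hausdorff1 (A c) <=
       \int[mu]_(m in slopes_over (normal_at 1) (A c)) (slope_density 1 m)%:E +
       \int[mu]_(m in slopes_over (normal_at (-1)) (A c)) (slope_density (-1) m)%:E)%E].
  move=> c0; apply: hausdorff1_curved_le => //.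
    by move=> x /(hA _ _ c0)[].
  by move=> x /(hA _ _ c0)[].
have mM sg c : sg = 1 \/ sg = -1 -> measurable (M sg c).
  rewrite /M; case: ifPn => // c0; have [m1 m2 _] := key c c0.
  by move=> [->|->].
have le1 c : c \in s -> (c%:E * hausdorff1 (A c) <=
    \int[mu]_(m in M 1%R c) (slope_density 1 m)%:E +
    \int[mu]_(m in M (-1)%R c) (slope_density (-1) m)%:E)%E.
  move=> cs; have : c \in range h by rewrite -(in_fset_set fin).
  rewrite inE => -[x _ <-].
  rewrite /M; case: ifPn => [/key[]//|].
  rewrite -leNgt => hx0; have -> : h x = 0 by apply/eqP; rewrite eq_le hx0 fun_ge0.
  by rewrite mul0e !integral_set0 adde0.
apply: (@le_trans _ _ (\sum_(c <- s) (\int[mu]_(m in M 1%R c) (slope_density 1 m)%:E +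
    \int[mu]_(m in M (-1)%R c) (slope_density (-1) m)%:E))%E).
  by rewrite big_seq [leRHS]big_seq; apply: lee_sum => c; exact: le1.
rewrite big_split /=.
have mD sg : measurable_fun [set: R] (fun m => (slope_density sg m)%:E).
  exact/measurable_EFinP.
have tot sg : sg = 1 \/ sg = -1 -> (\sum_(c <- s) \int[mu]_(m in M sg c) (slope_density sg m)%:E
    <= \int[mu]_m (slope_density sg m)%:E)%E.
  move=> sgE; have sg1 : sg ^+ 2 = 1 by case: sgE => ->; rewrite ?sqrrN expr1n.
  have mMs c : measurable (M sg c) by exact: mM.
  (* A slope common to two levels gives two curved contact points of one supporting line. They
     coincide, and [h] takes both values there. *)
  have tM : trivIset [set` s] (M sg).
    move=> c d cs ds [m []]; rewrite /M.
    case: ifPn => // c0; case: ifPn => // d0 [x Ax sx] [y Ay sy].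
    have xy : x = y.
      apply: (curved_point_unique (A := [set z | 0 < curvature E z]) _ (slope_dir_neq0 m sg1) _ sx sy) => //.
      by case: (hA c x c0 Ax).
    by rewrite -(Ax : h x = c) xy; exact: (Ay : h y = d).
  have p0 (D : set R) m : D m -> (0 <= (slope_density sg m)%:E)%E.
    by move=> _; rewrite lee_fin slope_density_ge0.
  rewrite -(ge0_integral_bigsetU mu mMs (finmap.fset_uniq _) tM); last 2 first.
  - exact: measurable_funS (mD sg).
  - exact: p0.
  apply: ge0_subset_integral => //; [|exact: mD|exact: p0].
  by apply: bigsetU_measurable => c _; exact: mM.
exact: (leeD (tot 1 (or_introl erefl)) (tot (-1) (or_intror erefl))).
Qed.

End total_curvature.

Theorem proposition3p1 (R : realType) (r : R) (f w : R -> R)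
  (r_gt0 : 0 < r)
  (f_gt0 : forall t : R, 0 <= t -> 0 < f t)
  (f_C1 : C1_halfline f)
  (f_nincr : forall s t : R, 0 <= s -> s <= t -> f t <= f s)
  (wE : forall t : R, 0 < t -> w t = - (derive1 f t / t)) :
  (forall E : set (R * R), convex_set E -> C11_set E -> E (0, 0) ->
    weighted_area w E = weighted_area w (eball r) ->
    (weighted_curvature f E <= weighted_curvature f (eball r))%E) /\
  ((forall s t : R, 0 < s -> s <= t -> w t <= w s) ->
   forall E : set (R * R), convex_set E -> C11_set E ->
    weighted_area w E = weighted_area w (eball r) ->
    (weighted_curvature f E <= weighted_curvature f (eball r))%E).
Proof.
have [f1 [f1_cont f_deriv f_deriv0]] := f_C1.
have main E : convex_set E -> C11_set E ->
    weighted_area w E = weighted_area w (eball r) ->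
    (weighted_curvature f E <= weighted_curvature f (eball r))%E.
  move=> cE [oE _] EA.
  apply: le_trans (weighted_curvature_eball_ge r_gt0 (f_gt0 r (ltW r_gt0))).
  exact: (weighted_curvature_le f_gt0 f_nincr f1_cont f_deriv f_deriv0 wE).
by split=> [E cE sE _|_ E]; exact: main.
Qed.
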